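(* Let $g$ be a pseudo-Riemannian metric on an $n$-dimensional manifold $M$ and let $H(p)=\frac12G_{\pi_M(p)}(p,p)$, $p\in T^*M$, with $G=g^{-1}$, be the associated geodesic Hamiltonian. Assume that $H$ is completely integrable, with functions $f_1,\dots,f_n\in C^\infty(T^*M)$ in involution satisfying the transversality condition, and consider the nonlinear connection on $T^*M$ defined by this completely integrable system and its linearization $D$. If the linearized connection $D$ is flat, then: (1) The nonlinear connection is in fact linear and equal to the dual of the Levi-Civita connection $\nabla$ for the metric $g$. (2) The Hamilton–Jacobi equation for $H$ is separable in any $\nabla$-affine coordinate system. (3) In any $\nabla$-affine coordinate system all coordinates are ignorable.
   Context: All objects are $C^\infty$; $\pi_M\colon T^*M\to M$, with canonical symplectic form $\omega_0=-d\theta_0$, $\theta_0=p_i\,dx^i$, and its canonical Poisson bracket. In coordinates, $H=\frac12g^{ij}(x)p_ip_j$. Complete integrability and the associated connection. The functions $f_1,\dots,f_n$ are functionally independent constants of the motion for $H$ in involution ($\{f_i,f_j\}=0$), $H$ is functionally dependent on them ($dH$ lies in the span of $df_1,\dots,df_n$ at each point), and the following transversality condition is assumed: the matrix $[\partial f_i/\partial p_j]$ is regular at every point of $T^*M$ (equivalently $d^Vf_1\wedge\cdots\wedge d^Vf_n\neq0$, where $d^Vf=\frac{\partial f}{\partial p_j}\frac{\partial}{\partial x^j}$). The Hamiltonian vector fields $X_{f_1},\dots,X_{f_n}$ then span an $n$-dimensional distribution $\mathrm{Hor}$ on $T^*M$, complementary to the vertical bundle $\ker T\pi_M$; it is the annihilator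 of $\operatorname{span}\{df_1,\dots,df_n\}$. This is the horizontal distribution of the nonlinear connection defined by the system. Linearization. For a nonlinear connection on $\pi_M\colon E=T^*M\to M$ with horizontal distribution $\mathrm{Hor}$, let $\xi^V(p,\beta)=\frac{d}{ds}(p+s\beta)|_{s=0}$ be the vertical lift, and $\alpha^V(p)=\xi^V(p,\alpha(p))$ for a 1-form $\alpha$ along $\pi_M$ (a section of $\pi_M^*T^*M\to T^*M$, viewed as a map $T^*M\to T^*M$ over $\pi_M$). Let $\kappa\colon TT^*M\to\pi_M^*T^*M$ be the vector bundle morphism over $\mathrm{id}_{T^*M}$ with $\kappa\circ\xi^V=\mathrm{id}$, $\kappa|_{\mathrm{Hor}}=0$; $P_V=\xi^V\circ\kappa$, $P_H=\mathrm{id}-P_V$. The linearized connection is the linear connection on $\pi_M^*T^*M\to T^*M$ with covariant derivative $D_U\alpha=\kappa([P_H(U),\alpha^V])+\kappa(T\alpha(P_V(U)))$, the last term at $p$ being the derivative of $\alpha$ restricted to the fibre $T^*_{\pi_M(p)}M$ in the vertical direction $P_V(U)_p$. In coordinates, if $H_i=\frac{\partial}{\partial x^i}-\Gamma_{ij}(x,p)\frac{\partial}{\partial p_j}$ spans $\mathrm{Hor}$, then $D_{H_i}dx^k=\frac{\partial\Gamma_{ij}}{\partial p_k}dx^j$ and $D_{\partial/\partial p_i}dx^k=0$. $D$ is flat if its curvature vanishes. A nonlinear connection is linear if it is the horizontal distribution of a linear connection (covariant derivative) on the vector bundle $T^*M\to M$. Terminology. The dual of $\nabla$ is the induced linear connection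 on $T^*M$. A $\nabla$-affine coordinate system is a local coordinate system on $M$ in which the Christoffel symbols of $\nabla$ vanish. A solution of the Hamilton–Jacobi equation is a closed 1-form $\alpha$ (locally $\alpha=dS$) such that $H\circ\alpha$ is constant; a complete solution is a foliation of the cotangent bundle (here over the coordinate domain) whose leaves are images of solutions, given by a family $\alpha_\lambda=dS_\lambda$, $\lambda\in\Lambda\subset\mathbb{R}^n$. The equation is separable in coordinates $(x^i)$ if there is a complete solution with $S_\lambda$ in separated form, i.e. a sum of functions each depending on a single coordinate $x^i$ (and on $\lambda$). A coordinate $x^i$ is ignorable if $\partial H/\partial x^i=0$ in the induced coordinates $(x^i,p_i)$.
   Formalization: In (2), a solution of the Hamilton–Jacobi equation is required to have H∘α constant only on each connected subset of the coordinate domain; for connected domains this is the literal definition, and for disconnected domains the literal claim can fail. *)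

(* Defs.v *)
From HB Require Import structures.
From mathcomp Require Import all_boot all_order all_algebra.
From mathcomp Require Import all_classical all_reals all_analysis.
Set Implicit Arguments.
Unset Strict Implicit.
Unset Printing Implicit Defensive.
Import Order.TTheory GRing.Theory Num.Theory.
Import numFieldNormedType.Exports.
Local Open Scope classical_set_scope.
Local Open Scope ring_scope.

(* Geometric objects are written in coordinates.  Tangent and cotangent       *)
(* vectors are row vectors of components, a vector field on an open subset of *)
(* R^n is a total function of which only the values on that subset matter,    *)
(* and 'J f x acts on the right: 'D_v f x = v *m 'J f x.                      *)

Section Smooth.
Context {R : realType}.

Fixpoint iter_derive {V W : normedModType R} (vs : seq V) (f : V -> W) :
    V -> W :=
  if vs is v :: vs' then fun x => 'D_v (iter_derive vs' f) x else f.

(* C^infty when A is open and V is finite dimensional: all iterated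
   directional derivatives are differentiable, hence continuous, on A. *)
Definition smooth_on {V W : normedModType R} (A : set V) (f : V -> W) : Prop :=
  forall (vs : seq V) (x : V), A x -> differentiable (iter_derive vs f) x.

Definition lie_bracket {V : normedModType R} (X Y : V -> V) : V -> V :=
  fun x => 'D_(X x) Y x - 'D_(Y x) X x.

Definition coord_vec n (i : 'I_n) : 'rV[R]_n := delta_mx 0 i.

Definition pairing n (p v : 'rV[R]_n) : R := \sum_i p 0 i * v 0 i.

Definition gradient n (S : 'rV[R]_n -> R) (x : 'rV[R]_n) : 'rV[R]_n :=
  \row_i 'D_(coord_vec i) S x.

End Smooth.

Section Manifolds.
Context {R : realType} {n : nat}.

Record chart (M : topologicalType) := Chart {
  dom : set M ;
  coord :> M -> 'rV[R]_n ;
  param : 'rV[R]_n -> M }.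

Definition img (M : topologicalType) (c : chart M) : set 'rV[R]_n :=
  c @` dom c.

Definition topological_chart (M : topologicalType) (c : chart M) : Prop :=
  [/\ open (dom c), open (img c),
      (forall m, dom c m -> param c (c m) = m),
      {within dom c, continuous c}
    & {within img c, continuous (param c)}].

Definition overlap (M : topologicalType) (c d : chart M) : set 'rV[R]_n :=
  c @` (dom c `&` dom d).

Definition trans (M : topologicalType) (c d : chart M) :
    'rV[R]_n -> 'rV[R]_n :=
  fun x => d (param c x).

Definition compatible (M : topologicalType) (c d : chart M) : Prop :=
  smooth_on (overlap c d) (trans c d) /\ smooth_on (overlap d c) (trans d c).

(* chart_at selects a reference chart around each point.  The fibres of TM and
   T^*M at m are modelled by the components in the coordinates chart_at m; the
   maps below give the components in any other coordinates. *)
Record manifold := Manifold {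
  carrier :> topologicalType ;
  atlas : set (chart carrier) ;
  chart_at : carrier -> chart carrier ;
  manifold_hausdorff : hausdorff_space carrier ;
  manifold_second_countable : @second_countable carrier ;
  atlas_topological : forall c, atlas c -> topological_chart c ;
  atlas_compatible : forall c d, atlas c -> atlas d -> compatible c d ;
  chart_at_atlas : forall m, atlas (chart_at m) ;
  chart_at_dom : forall m, dom (chart_at m) m }.

Definition coordinate_system (M : manifold) (c : chart M) : Prop :=
  topological_chart c /\ forall d, atlas d -> compatible c d.

Definition tangent_trans (M : topologicalType) (c d : chart M)
    (x v : 'rV[R]_n) : 'rV[R]_n :=
  v *m 'J (trans c d) x.

Definition cotangent_trans (M : topologicalType) (c d : chart M)
    (x p : 'rV[R]_n) : 'rV[R]_n :=
  p *m ('J (trans d c) (trans c d x))^T.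

End Manifolds.

Arguments chart R n M : clear implicits.
Arguments manifold R n : clear implicits.

Section LinearConnections.
Context {R : realType} {n : nat} (M : manifold R n).

Local Notation field := ('rV[R]_n -> 'rV[R]_n).

(* The covariant derivative of a linear connection on a rank n vector bundle
   over M (TM or T^*M, according to the change of fibre components tr), as a
   family of operators on fields over open sets of coordinates.  Locality is
   the case c = d of lc_natural. *)
Definition covariant_derivative := chart R n M -> field -> field -> field.

Record linear_connection
    (tr : chart R n M -> chart R n M -> 'rV[R]_n -> 'rV[R]_n -> 'rV[R]_n)
    (nabla : covariant_derivative) : Prop := LinearConnection {
  lc_smooth : forall c (W : set 'rV[R]_n) (X Y : field),
    coordinate_system c -> open W -> W `<=` img c ->
    smooth_on W X -> smooth_on W Y -> smooth_on W (nabla c X Y) ;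
  lc_linear : forall c (W : set 'rV[R]_n) (h : 'rV[R]_n -> R) (X X' Y : field),
    coordinate_system c -> open W -> W `<=` img c -> smooth_on W h ->
    smooth_on W X -> smooth_on W X' -> smooth_on W Y ->
    forall x, W x ->
      nabla c (fun y => h y *: X y + X' y) Y x =
      h x *: nabla c X Y x + nabla c X' Y x ;
  lc_additive : forall c (W : set 'rV[R]_n) (X Y Y' : field),
    coordinate_system c -> open W -> W `<=` img c ->
    smooth_on W X -> smooth_on W Y -> smooth_on W Y' ->
    forall x, W x ->
      nabla c X (fun y => Y y + Y' y) x = nabla c X Y x + nabla c X Y' x ;
  lc_leibniz : forall c (W : set 'rV[R]_n) (h : 'rV[R]_n -> R) (X Y : field),
    coordinate_system c -> open W -> W `<=` img c ->
    smooth_on W h -> smooth_on W X -> smooth_on W Y ->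
    forall x, W x ->
      nabla c X (fun y => h y *: Y y) x =
      'D_(X x) h x *: Y x + h x *: nabla c X Y x ;
  lc_natural : forall c d (W : set 'rV[R]_n) (X Y X' Y' : field),
    coordinate_system c -> coordinate_system d ->
    open W -> W `<=` overlap c d ->
    smooth_on W X -> smooth_on W Y ->
    smooth_on (trans c d @` W) X' -> smooth_on (trans c d @` W) Y' ->
    (forall x, W x -> X' (trans c d x) = tangent_trans c d x (X x)) ->
    (forall x, W x -> Y' (trans c d x) = tr c d x (Y x)) ->
    forall x, W x -> nabla d X' Y' (trans c d x) = tr c d x (nabla c X Y x) }.

(* (nabla^*_X alpha)(e_j) = X(alpha(e_j)) - alpha(nabla_X e_j) *)
Definition dual_connection (nabla : covariant_derivative) :
    covariant_derivative :=
  fun c X alpha x =>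
    \row_j ('D_(X x) (fun y => alpha y 0 j) x
            - pairing (alpha x) (nabla c X (cst (coord_vec j)) x)).

Definition christoffel (nabla : covariant_derivative) (c : chart R n M)
    (i j k : 'I_n) (x : 'rV[R]_n) : R :=
  nabla c (cst (coord_vec i)) (cst (coord_vec j)) x 0 k.

Definition affine_coordinates (nabla : covariant_derivative)
    (c : chart R n M) : Prop :=
  coordinate_system c /\
  forall i j k x, img c x -> christoffel nabla c i j k x = 0.

End LinearConnections.

Section Metrics.
Context {R : realType} {n : nat} (M : manifold R n).

(* g m is the Gram matrix of the metric at m in the reference chart at m. *)
Definition local_metric (g : M -> 'M[R]_n) (c : chart R n M) (x : 'rV[R]_n) :
    'M[R]_n :=
  let m := param c x in
  let A := 'J (trans c (chart_at m)) x in
  A *m g m *m A^T.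

Record pseudo_riemannian (g : M -> 'M[R]_n) : Prop := PseudoRiemannian {
  metric_sym : forall m, (g m)^T = g m ;
  metric_nondegenerate : forall m, g m \in unitmx ;
  metric_smooth : forall c, coordinate_system c ->
    smooth_on (img c) (local_metric g c) }.

Definition inner (g : M -> 'M[R]_n) (c : chart R n M) (x v w : 'rV[R]_n) : R :=
  (v *m local_metric g c x *m w^T) 0 0.

Record levi_civita (g : M -> 'M[R]_n) (nabla : covariant_derivative M) :
    Prop := LeviCivita {
  lc_connection : linear_connection (@tangent_trans R n M) nabla ;
  lc_torsion_free : forall c (W : set 'rV[R]_n) (X Y : 'rV[R]_n -> 'rV[R]_n),
    coordinate_system c -> open W -> W `<=` img c ->
    smooth_on W X -> smooth_on W Y ->
    forall x, W x -> nabla c X Y x - nabla c Y X x = lie_bracket X Y x ;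
  lc_metric : forall c (W : set 'rV[R]_n) (X Y Z : 'rV[R]_n -> 'rV[R]_n),
    coordinate_system c -> open W -> W `<=` img c ->
    smooth_on W X -> smooth_on W Y -> smooth_on W Z ->
    forall x, W x ->
      'D_(X x) (fun y => inner g c y (Y y) (Z y)) x =
      inner g c x (nabla c X Y x) (Z x) + inner g c x (Y x) (nabla c X Z x) }.

End Metrics.

Section CotangentBundle.
Context {R : realType} {n : nat} (M : manifold R n).

Local Notation phase := ('rV[R]_n * 'rV[R]_n)%type.

Definition cotangent : Type := (M * 'rV[R]_n)%type.

Definition phase_img (c : chart R n M) : set phase :=
  [set z | img c z.1].

(* F in the coordinates (x, p) of T^*M induced by c. *)
Definition local_fun (F : cotangent -> R) (c : chart R n M) : phase -> R :=
  fun z => let m := param c z.1 in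
    F (m, cotangent_trans c (chart_at m) z.1 z.2).

Definition smooth_fun (F : cotangent -> R) : Prop :=
  forall c, coordinate_system c -> smooth_on (phase_img c) (local_fun F c).

Definition geodesic_hamiltonian (g : M -> 'M[R]_n) : cotangent -> R :=
  fun q => 2^-1 * (q.2 *m invmx (g q.1) *m q.2^T) 0 0.

Definition d_x (i : 'I_n) (F : phase -> R) (z : phase) : R :=
  'D_((coord_vec i, 0) : phase) F z.

Definition d_p (i : 'I_n) (F : phase -> R) (z : phase) : R :=
  'D_((0, coord_vec i) : phase) F z.

Definition poisson (F G : phase -> R) (z : phase) : R :=
  \sum_i (d_x i F z * d_p i G z - d_p i F z * d_x i G z).

(* i_X omega_0 = dF for omega_0 = dx^i /\ dp_i *)
Definition hamiltonian_field (F : phase -> R) (z : phase) : phase :=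
  (\row_i d_p i F z, \row_i - d_x i F z).

Record completely_integrable (H : cotangent -> R)
    (f : 'I_n -> cotangent -> R) : Prop := CompletelyIntegrable {
  ci_smooth : forall i, smooth_fun (f i) ;
  ci_independent : forall c z, coordinate_system c -> phase_img c z ->
    forall a : 'I_n -> R,
      (forall u : phase, \sum_i a i * 'D_u (local_fun (f i) c) z = 0) ->
      forall i, a i = 0 ;
  ci_constant : forall c z i, coordinate_system c -> phase_img c z ->
    poisson (local_fun (f i) c) (local_fun H c) z = 0 ;
  ci_involution : forall c z i j, coordinate_system c -> phase_img c z ->
    poisson (local_fun (f i) c) (local_fun (f j) c) z = 0 ;
  ci_dependent : forall c z, coordinate_system c -> phase_img c z ->
    exists a : 'I_n -> R, forall u : phase,
      'D_u (local_fun H c) z = \sum_i a i * 'D_u (local_fun (f i) c) z }.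

Definition transversality (f : 'I_n -> cotangent -> R) : Prop :=
  forall c z, coordinate_system c -> phase_img c z ->
    \matrix_(i < n, j < n) d_p j (local_fun (f i) c) z \in unitmx.

(* A distribution on T^*M, in induced coordinates. *)
Definition distribution := chart R n M -> phase -> set phase.

Definition integrable_hor (f : 'I_n -> cotangent -> R) : distribution :=
  fun c z => [set u | exists a : 'I_n -> R,
    u = \sum_i a i *: hamiltonian_field (local_fun (f i) c) z].

(* For a covariant derivative on T^*M: the tangent vectors of the 1-forms with
   vanishing covariant derivative at the point. *)
Definition linear_hor (C : covariant_derivative M) : distribution :=
  fun c z => [set u | exists alpha : 'rV[R]_n -> 'rV[R]_n,
    [/\ smooth_on (img c) alpha, alpha z.1 = z.2,
        C c (cst u.1) alpha z.1 = 0 & u.2 = 'D_(u.1) alpha z.1]].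

Definition same_distribution (Hor Hor' : distribution) : Prop :=
  forall c z, coordinate_system c -> phase_img c z -> Hor c z = Hor' c z.

Definition is_linear (Hor : distribution) : Prop :=
  exists C : covariant_derivative M,
    linear_connection (@cotangent_trans R n M) C /\
    same_distribution Hor (linear_hor C).

Section Linearization.
Variable hor : phase -> set phase.

Definition vlift (alpha : phase -> 'rV[R]_n) : phase -> phase :=
  fun z => (0, alpha z).

(* When hor z is a complement of the vertical space, kappa z u is the unique w
   with u - xi^V(w) horizontal. *)
Definition kappa (z u : phase) : 'rV[R]_n :=
  xget 0 [set w : 'rV[R]_n | hor z (u - (0, w))].

Definition vproj (U : phase -> phase) : phase -> phase :=
  vlift (fun z => kappa z (U z)).

Definition hproj (U : phase -> phase) : phase -> phase :=
  fun z => U z - vproj U z.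

Definition linearized (U : phase -> phase) (alpha : phase -> 'rV[R]_n) :
    phase -> 'rV[R]_n :=
  fun z => kappa z (lie_bracket (hproj U) (vlift alpha) z)
           + 'D_(vproj U z) alpha z.

Definition curvature (U W : phase -> phase) (alpha : phase -> 'rV[R]_n) :
    phase -> 'rV[R]_n :=
  fun z => linearized U (linearized W alpha) z
           - linearized W (linearized U alpha) z
           - linearized (lie_bracket U W) alpha z.

End Linearization.

Definition linearization_flat (Hor : distribution) : Prop :=
  forall c (U W : phase -> phase) (alpha : phase -> 'rV[R]_n),
    coordinate_system c -> smooth_on (phase_img c) U ->
    smooth_on (phase_img c) W -> smooth_on (phase_img c) alpha ->
    forall z, phase_img c z -> curvature (Hor c) U W alpha z = 0.

Definition ignorable (H : cotangent -> R) (c : chart R n M) (i : 'I_n) : Prop :=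
  forall z, phase_img c z -> d_x i (local_fun H c) z = 0.

(* The domain of c need not be connected; "H o alpha is constant" is then
   understood on each component. *)
Definition hj_solution (H : cotangent -> R) (c : chart R n M)
    (alpha : 'rV[R]_n -> 'rV[R]_n) : Prop :=
  [/\ smooth_on (img c) alpha,
      (forall x i j, img c x ->
        'D_(coord_vec i) (fun y => alpha y 0 j) x =
        'D_(coord_vec j) (fun y => alpha y 0 i) x)
    & forall A : set 'rV[R]_n, A `<=` img c -> connected A ->
        forall x y, A x -> A y ->
          local_fun H c (x, alpha x) = local_fun H c (y, alpha y)].

(* The foliation by the images of the dS_lambda is expressed by requiring
   (lambda, x) |-> (x, dS_lambda(x)) to be a diffeomorphism from Lambda x img c
   onto phase_img c; (x, p) |-> (label (x, p), x) is its inverse. *)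
Definition complete_solution (H : cotangent -> R) (c : chart R n M)
    (Lambda : set 'rV[R]_n) (S : 'rV[R]_n -> 'rV[R]_n -> R) : Prop :=
  [/\ open Lambda,
      (forall l, Lambda l -> smooth_on (img c) (S l)),
      (forall l, Lambda l -> hj_solution H c (gradient (S l))),
      smooth_on (Lambda `*` img c)
        (fun lx : phase => gradient (S lx.1) lx.2)
    & exists label : phase -> 'rV[R]_n,
        [/\ smooth_on (phase_img c) label,
            (forall z, phase_img c z ->
               Lambda (label z) /\ gradient (S (label z)) z.1 = z.2)
          & forall l x, Lambda l -> img c x ->
               label (x, gradient (S l) x) = l]].

Definition separated (c : chart R n M) (S : 'rV[R]_n -> R) : Prop :=
  exists s : 'I_n -> R -> R,
    (forall i, smooth_on [set x 0 i | x in img c] (s i : R^o -> R^o)) /\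
    (forall x, img c x -> S x = \sum_i s i (x 0 i)).

Definition separable (H : cotangent -> R) (c : chart R n M) : Prop :=
  exists (Lambda : set 'rV[R]_n) (S : 'rV[R]_n -> 'rV[R]_n -> R),
    complete_solution H c Lambda S /\
    forall l, Lambda l -> separated c (S l).

End CotangentBundle.

(* Main.v *)
Require Import Defs.
From mathcomp Require Import all_boot all_order all_algebra.
From mathcomp Require Import all_classical all_reals all_analysis.
From mathcomp Require Import ring lra.
Set Implicit Arguments.
Unset Strict Implicit.
Unset Printing Implicit Defensive.
Import Order.TTheory GRing.Theory Num.Theory.
Import numFieldNormedType.Exports.
Local Open Scope classical_set_scope.
Local Open Scope ring_scope.

(** In a chart the matrices of the derivatives of the f_i along the base and
    along the fibres are related by involution, and the second one is invertible
    by transversality; hence the Hamiltonian fields span the graph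
    [u.2 = - u.1 *m Gamma(x, p)] of a symmetric matrix Gamma, which is
    [connection_mx] ([integrable_horE], [connection_mx_sym]).  Since dH is a
    combination of the df_i, which annihilate this graph, H is constant along
    it: dH/dx = dH/dp *m Gamma ([hamiltonian_transport]).

    Flatness of the linearization says that the second derivatives of Gamma
    along the fibres vanish ([flat_second_derivative]), so Gamma is affine in p
    ([connection_mx_affine]).  As H is quadratic in p, comparing the homogeneous
    components of the previous equation kills the constant term of Gamma, and
    shows that its linear part preserves the cometric.  Symmetry of Gamma is the
    absence of torsion, so the linear part consists, up to sign, of the
    Christoffel symbols of the Levi-Civita connection
    ([transport_eq_levi_civita], [connection_mx_christoffel]).  The graph is then the horizontal distribution
    of the dual of the Levi-Civita connection ([linear_horE]), which is a linear
    connection on the cotangent bundle ([dual_linear_connection]).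

    In affine coordinates Gamma = 0, and dH/dx = dH/dp *m Gamma reads dH/dx = 0:
    every coordinate is ignorable ([affine_ignorable]).  For the same reason the
    constant 1-forms solve the Hamilton-Jacobi equation, and the functions
    x |-> sum_i l_i x_i form a complete solution in separated form
    ([affine_separable]). *)

(** * Smooth maps *)

Section Germs.
Context {R : realType} {V W : normedModType R}.
Implicit Types (f g : V -> W) (A : set V).

Lemma open_near A f g x : open A -> A x -> {in A, f =1 g} ->
  \forall y \near x, f y = g y.
Proof.
move=> oA Ax fg; have : nbhs x A by exact: open_nbhs_nbhs.
by apply: filterS => y Ay; apply: fg; rewrite inE.
Qed.

(** Differentiability only depends on the germ: the differential of [f] also
    approximates [g]. *)
Lemma near_eq_differentiable f g x :
  (\forall y \near x, f y = g y) -> differentiable f x -> differentiable g x.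
Proof.
move=> fg df.
have gE : g \o shift x = cst (g x) + 'd f x +o_ 0 id.
  have /diff_locallyP[_ /eqaddoP fE] := df.
  apply/eqaddoP => e e0.
  have fg0 : \forall h \near (0 : V), f (h + x) = g (h + x).
    rewrite (near_shift x) /=.
    by apply: filterS fg => y; rewrite /= sub0r subrK.
  have := fE e e0; apply: filterS2 fg0 => h fgh.
  by rewrite /= !fctE /= -fgh -(nbhs_singleton fg).
have dc : continuous ('d f x) by exact: diff_continuous.
apply/diff_locallyP; split.
  by rewrite (diff_unique dc gE).
by rewrite (diff_unique dc gE).
Qed.

Lemma eq_differentiable_on A f g x : open A -> A x -> {in A, f =1 g} ->
  differentiable f x -> differentiable g x.
Proof.
by move=> oA Ax fg; exact/near_eq_differentiable/(open_near oA Ax fg).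
Qed.

Lemma eq_derive_on A f g x v : open A -> A x -> {in A, f =1 g} ->
  'D_v f x = 'D_v g x.
Proof. by move=> oA Ax fg; exact/near_eq_derive/(open_near oA Ax fg). Qed.

End Germs.

Section Smoothness.
Context {R : realType} {V : normedModType R}.
Implicit Types A : set V.

(** The finite stages of smoothness.  The derivative of a product, an inverse or
    a composite involves the original functions together with their
    derivatives, so closure properties go by induction on the order. *)
Definition smooth_order {W : normedModType R} k A (f : V -> W) :=
  forall vs x, (size vs <= k)%N -> A x -> differentiable (iter_derive vs f) x.

Lemma smooth_orderP {W : normedModType R} A (f : V -> W) :
  smooth_on A f <-> forall k, smooth_order k A f.
Proof.
split=> [sf k vs x _|sf vs x Ax]; first exact: sf.
exact: (sf (size vs)).
Qed.

Lemma iter_derive_rcons {W : normedModType R} vs v (f : V -> W) :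
  iter_derive (rcons vs v) f = iter_derive vs ('D_v f).
Proof. by elim: vs => //= w vs ->. Qed.

Lemma smooth_on_differentiable {W : normedModType R} A (f : V -> W) x :
  smooth_on A f -> A x -> differentiable f x.
Proof. by move=> sf; exact: (sf [::]). Qed.

Lemma smooth_on_derive {W : normedModType R} A (f : V -> W) v :
  smooth_on A f -> smooth_on A ('D_v f).
Proof. by move=> sf vs x Ax; rewrite -iter_derive_rcons; exact: sf. Qed.

Lemma smooth_order0 {W : normedModType R} A (f : V -> W) :
  smooth_order 0 A f <-> forall x, A x -> differentiable f x.
Proof.
split=> [sf x|df [] // x _]; [exact: (sf [::])|exact: df].
Qed.

(** [iter_derive] applies the first direction of the list last; for inductions
    it is the innermost derivative that has to be split off. *)
Lemma smooth_orderS {W : normedModType R} k A (f : V -> W) :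
  smooth_order k.+1 A f <->
  (forall x, A x -> differentiable f x) /\
  (forall v, smooth_order k A ('D_v f)).
Proof.
split=> [sf|[df sDf] vs x]; first split.
- by move=> x; exact: (sf [::]).
- move=> v vs x sz Ax; rewrite -iter_derive_rcons.
  by apply: sf; rewrite ?size_rcons.
- case: (lastP vs) => [_|ws v]; first exact: df.
  by rewrite size_rcons iter_derive_rcons; exact: sDf.
Qed.

Lemma smooth_order_differentiable {W : normedModType R} k A (f : V -> W) x :
  smooth_order k A f -> A x -> differentiable f x.
Proof. by move=> sf; exact: (sf [::]). Qed.

Lemma smooth_order_leS {W : normedModType R} k A (f : V -> W) :
  smooth_order k.+1 A f -> smooth_order k A f.
Proof. by move=> sf vs x sz; apply: sf; exact: leqW. Qed.

Lemma eq_iter_derive {W : normedModType R} A (f g : V -> W) vs :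
  open A -> {in A, f =1 g} -> {in A, iter_derive vs f =1 iter_derive vs g}.
Proof.
move=> oA fg; elim: vs => //= v vs IH x; rewrite inE => Ax.
exact: (eq_derive_on _ oA Ax IH).
Qed.

Lemma eq_smooth_order {W : normedModType R} k A (f g : V -> W) :
  open A -> {in A, f =1 g} -> smooth_order k A f -> smooth_order k A g.
Proof.
move=> oA fg sf vs x sz Ax; have e := eq_iter_derive vs oA fg.
exact: (eq_differentiable_on oA Ax e (sf vs x sz Ax)).
Qed.

Lemma eq_smooth_on {W : normedModType R} A (f g : V -> W) :
  open A -> {in A, f =1 g} -> smooth_on A f -> smooth_on A g.
Proof.
move=> oA fg /smooth_orderP sf; apply/smooth_orderP => k.
exact: eq_smooth_order (sf k).
Qed.

Lemma smooth_on_cover {W : normedModType R} A (f : V -> W) :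
  (forall x, A x -> exists2 B, B x & smooth_on B f) -> smooth_on A f.
Proof. by move=> H vs x /H[B Bx sf]; exact: sf. Qed.

Lemma smooth_on_subset {W : normedModType R} A B (f : V -> W) :
  A `<=` B -> smooth_on B f -> smooth_on A f.
Proof. by move=> AB sf vs x /AB; exact: sf. Qed.

Lemma iter_derive_cst {W : normedModType R} vs (w : W) :
  exists w', iter_derive vs (cst w : V -> W) = cst w'.
Proof.
elim: vs => /= [|v vs [w' ->]]; first by exists w.
by exists 0; apply/funext => x; rewrite derive_cst.
Qed.

Lemma smooth_on_cst {W : normedModType R} A (w : W) : smooth_on A (cst w).
Proof.
move=> vs x _; have [w' ->] := iter_derive_cst vs w; exact: differentiable_cst.
Qed.

Lemma smooth_orderD {W : normedModType R} k A (f g : V -> W) : open A ->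
  smooth_order k A f -> smooth_order k A g ->
  smooth_order k A (fun x => f x + g x).
Proof.
move=> oA; elim: k f g => [|k IH] f g.
  rewrite !smooth_order0 => df dg x Ax.
  by apply: differentiableD; [exact: df|exact: dg].
move=> /smooth_orderS[df sf] /smooth_orderS[dg sg]; apply/smooth_orderS; split.
  by move=> x Ax; apply: differentiableD; [exact: df|exact: dg].
move=> v; apply: eq_smooth_order (IH _ _ (sf v) (sg v)) => // x.
rewrite inE => Ax; rewrite deriveD //; apply: diff_derivable; auto.
Qed.

Lemma smooth_orderM k A (f g : V -> R) : open A ->
  smooth_order k A f -> smooth_order k A g ->
  smooth_order k A (fun x => f x * g x).
Proof.
move=> oA; elim: k f g => [|k IH] f g.
  rewrite !smooth_order0 => df dg x Ax.
  by apply: differentiableM; [exact: df|exact: dg].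
move=> /[dup] Sf /smooth_orderS[df sf] /[dup] Sg /smooth_orderS[dg sg].
apply/smooth_orderS; split.
  by move=> x Ax; apply: differentiableM; [exact: df|exact: dg].
move=> v; apply: eq_smooth_order (smooth_orderD oA
  (IH _ _ (smooth_order_leS Sf) (sg v))
  (IH _ _ (sf v) (smooth_order_leS Sg))) => // x.
rewrite inE => Ax; rewrite deriveM //; last 2 first.
- by apply: diff_derivable; exact: df.
- by apply: diff_derivable; exact: dg.
by rewrite [_ * g x]mulrC.
Qed.

Lemma smooth_orderV k A (f : V -> R) : open A -> (forall x, A x -> f x != 0) ->
  smooth_order k A f -> smooth_order k A (fun x => (f x)^-1).
Proof.
move=> oA f0; elim: k f f0 => [|k IH] f f0.
  rewrite !smooth_order0 => df x Ax.
  by apply: differentiableV; [exact: df|exact: f0].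
move=> /[dup] Sf /smooth_orderS[df sf]; apply/smooth_orderS; split.
  by move=> x Ax; apply: differentiableV; [exact: df|exact: f0].
move=> v; have If := IH f f0 (smooth_order_leS Sf).
have Sm1 : smooth_order k A (cst (-1 : R) : V -> R).
  by move=> vs x _; exact: smooth_on_cst.
apply: eq_smooth_order (smooth_orderM oA Sm1
  (smooth_orderM oA (smooth_orderM oA If If) (sf v))) => // x.
rewrite inE => Ax; rewrite deriveV ?f0 //; last exact/diff_derivable/df.
by rewrite -exprVn expr2 mulN1r scaleNr.
Qed.

Lemma smooth_onD {W : normedModType R} A (f g : V -> W) : open A ->
  smooth_on A f -> smooth_on A g -> smooth_on A (fun x => f x + g x).
Proof.
move=> oA /smooth_orderP sf /smooth_orderP sg; apply/smooth_orderP => k.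
exact: smooth_orderD.
Qed.

Lemma smooth_onM A (f g : V -> R) : open A ->
  smooth_on A f -> smooth_on A g -> smooth_on A (fun x => f x * g x).
Proof.
move=> oA /smooth_orderP sf /smooth_orderP sg; apply/smooth_orderP => k.
exact: smooth_orderM.
Qed.

Lemma smooth_onV A (f : V -> R) : open A -> (forall x, A x -> f x != 0) ->
  smooth_on A f -> smooth_on A (fun x => (f x)^-1).
Proof.
move=> oA f0 /smooth_orderP sf; apply/smooth_orderP => k; exact: smooth_orderV.
Qed.

Lemma smooth_on_sum {W : normedModType R} I (r : seq I) (P : pred I) A
    (f : I -> V -> W) : open A ->
  (forall i, P i -> smooth_on A (f i)) ->
  smooth_on A (fun x => \sum_(i <- r | P i) f i x).
Proof.
move=> oA sf; elim: r => [|i r IH].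
  by apply: eq_smooth_on oA _ (smooth_on_cst (0 : W)) => x _; rewrite big_nil.
have [Pi|nPi] := boolP (P i).
  apply: eq_smooth_on oA _ (smooth_onD oA (sf i Pi) IH) => x _.
  by rewrite big_cons Pi.
by apply: eq_smooth_on oA _ IH => x _; rewrite big_cons (negbTE nPi).
Qed.

Lemma smooth_on_prod I (r : seq I) A (f : I -> V -> R) : open A ->
  (forall i, smooth_on A (f i)) ->
  smooth_on A (fun x => \prod_(i <- r) f i x).
Proof.
move=> oA sf; elim: r => [|i r IH].
  by apply: eq_smooth_on oA _ (smooth_on_cst (1 : R)) => x _; rewrite big_nil.
by apply: eq_smooth_on oA _ (smooth_onM oA (sf i) IH) => x _; rewrite big_cons.
Qed.

Lemma smooth_on_mulmx m n p A (f : V -> 'M[R]_(m, n)) (h : V -> 'M[R]_(n, p)) :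
  open A -> (forall i j, smooth_on A (fun x => f x i j)) ->
  (forall i j, smooth_on A (fun x => h x i j)) ->
  forall i j, smooth_on A (fun x => (f x *m h x) i j).
Proof.
move=> oA sf sh i j.
apply: (@eq_smooth_on _ _ (fun x => \sum_k f x i k * h x k j)) => //.
  by move=> x _; rewrite mxE.
by apply: smooth_on_sum => // k _; exact: smooth_onM.
Qed.

Lemma smooth_on_det n A (f : V -> 'M[R]_n) : open A ->
  (forall i j, smooth_on A (fun x => f x i j)) ->
  smooth_on A (fun x => \det (f x)).
Proof.
move=> oA sf; apply: smooth_on_sum => // s _.
by apply: smooth_onM => //; [exact: smooth_on_cst|exact: smooth_on_prod].
Qed.

(** Cramer's rule makes the entries of the inverse rational functions of the
    entries. *)
Lemma smooth_on_invmx n A (f : V -> 'M[R]_n) : open A ->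
  (forall x, A x -> f x \in unitmx) ->
  (forall i j, smooth_on A (fun x => f x i j)) ->
  forall i j, smooth_on A (fun x => invmx (f x) i j).
Proof.
move=> oA uf sf i j.
pose h x := (\det (f x))^-1 * cofactor (f x) j i.
apply: (@eq_smooth_on _ _ h) => //.
  by move=> x; rewrite inE => /uf ufx; rewrite /invmx ufx !mxE.
apply: smooth_onM => //.
  apply: smooth_onV => //; last exact: smooth_on_det.
  by move=> x /uf; rewrite unitmxE unitfE.
apply: smooth_onM => //; first exact: smooth_on_cst.
apply: smooth_on_det => // k l.
by apply: eq_smooth_on oA _ (sf (lift j k) (lift i l)) => x _; rewrite !mxE.
Qed.

End Smoothness.

Section Components.
Context {R : realType} {V : normedModType R}.
Implicit Types A : set V.

Lemma differentiable_entry m n (f : V -> 'M[R]_(m, n)) x i j :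
  differentiable f x -> differentiable (fun y => f y i j) x.
Proof.
move=> df; pose e (N : 'M[R]_(m, n)) := N i j.
apply: (@differentiable_comp _ _ _ _ f e) => //.
exact: differentiable_coord.
Qed.

Lemma differentiable_mx m n (f : V -> 'M[R]_(m, n)) x :
  (forall i j, differentiable (fun y => f y i j) x) -> differentiable f x.
Proof.
move=> df.
have -> : f = \sum_(i < m) \sum_(j < n) (fun y => f y i j *: delta_mx i j).
  apply/funext => y; rewrite fct_sumE {1}[f y]matrix_sum_delta.
  by apply: eq_bigr => i _; rewrite fct_sumE.
apply: differentiable_sum => i; apply: differentiable_sum => j.
exact: differentiableZl.
Qed.

Lemma derive_entry m n (f : V -> 'M[R]_(m, n)) x v i j :
  differentiable f x -> 'D_v f x i j = 'D_v (fun y => f y i j) x.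
Proof. by move=> df; rewrite derive_mx ?mxE //; exact: diff_derivable. Qed.

Lemma smooth_on_mxP m n A (f : V -> 'M[R]_(m, n)) : open A ->
  smooth_on A f <-> forall i j, smooth_on A (fun y => f y i j).
Proof.
move=> oA; split=> [/smooth_orderP sf i j|sf].
  apply/smooth_orderP => k; elim: k f {sf}(sf k) => [|k IH] f.
    rewrite !smooth_order0 => df x Ax; exact/differentiable_entry/df.
  move=> /smooth_orderS[df sf]; apply/smooth_orderS; split=> [x Ax|v].
    exact/differentiable_entry/df.
  apply: eq_smooth_order (IH _ (sf v)) => // x; rewrite inE => Ax.
  by rewrite derive_entry //; exact: df.
apply/smooth_orderP => k.
have {}sf i j : smooth_order k A (fun y => f y i j).
  by move/smooth_orderP: (sf i j).
elim: k f sf => [|k IH] f sf.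
  rewrite smooth_order0 => x Ax; apply: differentiable_mx => i j.
  exact: smooth_order_differentiable (sf i j) Ax.
have df x : A x -> differentiable f x.
  move=> Ax; apply: differentiable_mx => i j.
  exact: smooth_order_differentiable (sf i j) Ax.
apply/smooth_orderS; split=> // v; apply: IH => i j.
have /smooth_orderS[_ /(_ v)] := sf i j; apply: eq_smooth_order => // x.
by rewrite inE => Ax; rewrite derive_entry //; exact: df.
Qed.

Lemma derive_comp {V' W : normedModType R} (T : V -> V') (f : V' -> W) x v :
  differentiable T x -> differentiable f (T x) ->
  'D_v (fun y => f (T y)) x = 'D_('D_v T x) f (T x).
Proof.
move=> dT df.
rewrite !deriveE //; last exact: differentiable_comp.
by rewrite (diff_comp dT df).
Qed.

Lemma derive_pair {W1 W2 : normedModType R} (f : V -> W1) (h : V -> W2) x v :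
  differentiable f x -> differentiable h x ->
  'D_v (fun y => (f y, h y)) x = ('D_v f x, 'D_v h x).
Proof.
move=> df dh; rewrite !deriveE //; last exact: differentiable_pair.
by rewrite diff_pair.
Qed.

Lemma derive_linear_dir {W : normedModType R} (f : V -> W) x a u v :
  differentiable f x -> 'D_(a *: u + v) f x = a *: 'D_u f x + 'D_v f x.
Proof. by move=> df; rewrite !deriveE // linearP. Qed.

Lemma is_derive_line {W : normedModType R} (f : V -> W) z v (t : R) :
  derivable f (z + t *: v) v ->
  is_derive t 1 (fun s => f (z + s *: v)) ('D_v f (z + t *: v)).
Proof.
have E : (fun h : R => h^-1 *: (f (z + (h *: (1 : R) + t) *: v) -
                                f (z + t *: v))) =
         (fun h : R => h^-1 *: (f (h *: v + (z + t *: v)) - f (z + t *: v))).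
  apply/funext => h; congr (_ *: (f _ - _)).
  by rewrite scalerDl addrCA [h *: 1]mulr1.
move=> df; apply: DeriveDef.
  by rewrite /derivable E.
by rewrite /derive E.
Qed.

(** The derivative along the line is constant, so the difference with the affine
    function of that slope is constant as well. *)
Lemma affine_along_line (f : V -> R) z v :
  (forall t, differentiable f (z + t *: v)) ->
  (forall t, differentiable ('D_v f) (z + t *: v)) ->
  (forall t, 'D_v ('D_v f) (z + t *: v) = 0) ->
  forall t, f (z + t *: v) = f z + t * 'D_v f z.
Proof.
move=> df dDf DD t.
have Dcst s : 'D_v f (z + s *: v) = 'D_v f z.
  rewrite -[in RHS](addr0 z) -(scale0r v).
  apply: (@is_derive_0_is_cst _ (fun s => 'D_v f (z + s *: v))) => r.
  by rewrite -(DD r); apply: is_derive_line; exact: diff_derivable.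
have : f (z + t *: v) - t * 'D_v f z = f (z + 0 *: v) - 0 * 'D_v f z.
  apply: (@is_derive_0_is_cst _ (fun s => f (z + s *: v) - s * 'D_v f z)) => r.
  have H1 : is_derive r 1 (fun s => f (z + s *: v)) ('D_v f z).
    by rewrite -(Dcst r); apply: is_derive_line; exact: diff_derivable.
  have H2 : is_derive r 1 (fun s : R => s * 'D_v f z) ('D_v f z).
    have := @is_deriveM _ _ id (cst ('D_v f z)) r 1 _ _
      (is_derive_id _ _) (is_derive_cst _ _ _).
    by rewrite scaler0 add0r [_ *: 1]mulr1; apply.
  by have := is_deriveB H1 H2; rewrite subrr; apply.
by rewrite scale0r addr0 mul0r subr0 => <-; rewrite subrK.
Qed.

(** Mean value theorem on the segments of a ball. *)
Lemma derive0_near_cst (U : set V) (f : V -> R) x : open U -> U x ->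
  (forall y, U y -> differentiable f y) ->
  (forall y v, U y -> 'D_v f y = 0) ->
  \forall y \near x, f y = f x.
Proof.
move=> oU Ux df D0.
have /nbhs_ballP[e e0 xeU] : nbhs x U by exact: open_nbhs_nbhs.
apply/nbhs_ballP; exists e => // y xy.
have inU (t : R) : t \in `[0, 1] -> U (x + t *: (y - x)).
  rewrite in_itv /= => /andP[t0 t1]; apply: xeU.
  move: xy; rewrite -!ball_normE /ball_ /= opprD addrA subrr sub0r normrN.
  rewrite normrZ ger0_norm // distrC; apply: le_lt_trans.
  by rewrite ler_piMl.
have dline (t : R) : t \in `[0, 1] ->
    is_derive t 1 (fun s => f (x + s *: (y - x))) 0.
  move=> /inU Ut; rewrite -(D0 _ (y - x) Ut); apply: is_derive_line.
  exact/diff_derivable/df.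
pose h (s : R) := f (x + s *: (y - x)).
have dh (t : R) : t \in `]0, 1[ -> is_derive t 1 h (cst 0 t).
  by move=> /subset_itv_oo_cc; exact: dline.
have ch : {within `[(0 : R), 1], continuous h}.
  by apply: derivable_within_continuous => t /dline[].
have [t _] := MVT_segment ler01 dh ch.
rewrite /h mul0r scale1r scale0r addr0 subrKC => /eqP.
by rewrite subr_eq0 => /eqP.
Qed.

(** The level sets of [f] are open in [U], hence relatively clopen in [A]. *)
Lemma derive0_connected_cst (U A : set V) (f : V -> R) : open U ->
  (forall y, U y -> differentiable f y) ->
  (forall y v, U y -> 'D_v f y = 0) ->
  A `<=` U -> connected A -> forall x y, A x -> A y -> f x = f y.
Proof.
move=> oU df D0 AU cA x y Ax Ay.
have oE (E : set R) : open [set z | U z /\ E (f z)].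
  rewrite openE => z [Uz Ez]; rewrite /interior /=.
  have nU : nbhs z U by exact: open_nbhs_nbhs.
  by have := derive0_near_cst oU Uz df D0; apply: filterS2 nU => w Uw /= ->.
suff E : [set z | A z /\ f z = f x] = A.
  by move: (Ay); rewrite -{1}E => -[_ ->].
apply: cA; first by exists x.
  exists [set z | U z /\ [set f x] (f z)]; first exact: oE.
  apply/seteqP; split=> z /= [] => [Az ->|Az [_ ->]] //.
  by split=> //; split=> //; exact: AU.
exists (~` [set z | U z /\ (~` [set f x]) (f z)]).
  exact/open_closedC/oE.
apply/seteqP; split=> z /=; first by move=> [Az ->]; split=> // -[_]; apply.
move=> [Az nz]; split=> //; apply: contrapT => ne; apply: nz; split=> //.
exact: AU.
Qed.

End Components.

Section Partials.
Context {R : realType} {V1 V2 W : normedModType R}.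

(** The difference quotients on both sides are the same. *)
Lemma derive_fst_dir (F : V1 * V2 -> W) x p v :
  'D_((v, 0) : V1 * V2) F (x, p) = 'D_v (fun y => F (y, p)) x.
Proof.
have E : (fun h : R => h^-1 *: (F (h *: ((v, 0) : V1 * V2) + (x, p)) -
                                F (x, p))) =
         (fun h : R => h^-1 *: (F (h *: v + x, p) - F (x, p))).
  apply/funext => h; congr (_ *: (F _ - _)).
  by congr pair; rewrite /= scaler0 add0r.
by rewrite /derive E.
Qed.

Lemma derive_snd_dir (F : V1 * V2 -> W) x p v :
  'D_((0, v) : V1 * V2) F (x, p) = 'D_v (fun q => F (x, q)) p.
Proof.
have E : (fun h : R => h^-1 *: (F (h *: ((0, v) : V1 * V2) + (x, p)) -
                                F (x, p))) =
         (fun h : R => h^-1 *: (F (x, h *: v + p) - F (x, p))).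
  apply/funext => h; congr (_ *: (F _ - _)).
  by congr pair; rewrite /= scaler0 add0r.
by rewrite /derive E.
Qed.

End Partials.

Section Composition.
Context {R : realType} {V : normedModType R}.
Implicit Types A : set V.

Lemma row_sum_coord_vec n (v : 'rV[R]_n) : v = \sum_i v 0 i *: coord_vec i.
Proof. exact: row_sum_delta. Qed.

Lemma derive_coord_sum n {W : normedModType R} (f : 'rV[R]_n -> W) x v :
  differentiable f x -> 'D_v f x = \sum_i v 0 i *: 'D_(coord_vec i) f x.
Proof.
move=> df; rewrite deriveE // {1}[v]row_sum_coord_vec linear_sum.
by apply: eq_bigr => i _; rewrite linearZ deriveE.
Qed.

(** The derivative of [f \o T] is a sum of products of derivatives of the
    components of [T] with partial derivatives of [f] composed with [T], to
    which the induction hypothesis applies. *)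
Lemma smooth_on_comp n A B (T : V -> 'rV[R]_n) (f : 'rV[R]_n -> R) : open A ->
  (forall x, A x -> B (T x)) -> smooth_on A T -> smooth_on B f ->
  smooth_on A (fun x => f (T x)).
Proof.
move=> oA AB sT sf; apply/smooth_orderP => k; elim: k f sf => [|k IH] f sf.
  rewrite smooth_order0 => x Ax; apply: differentiable_comp.
    exact: smooth_on_differentiable sT Ax.
  by apply: smooth_on_differentiable sf _; exact: AB.
apply/smooth_orderS; split=> [x Ax|v].
  apply: differentiable_comp; first exact: smooth_on_differentiable sT Ax.
  by apply: smooth_on_differentiable sf _; exact: AB.
pose Df x := \sum_i 'D_v T x 0 i * 'D_(coord_vec i) f (T x).
apply: (@eq_smooth_order _ _ _ _ _ Df) => //.
  move=> x; rewrite inE => Ax; rewrite derive_comp.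
  - rewrite derive_coord_sum //.
    by apply: smooth_on_differentiable sf _; exact: AB.
  - exact: smooth_on_differentiable sT Ax.
  - by apply: smooth_on_differentiable sf _; exact: AB.
rewrite /Df; elim: (index_enum _) => [|i r IHr].
  apply: (@eq_smooth_order _ _ _ _ _ (cst 0)) => //.
    by move=> x _; rewrite big_nil.
  by move=> vs x _; exact: smooth_on_cst.
apply: (@eq_smooth_order _ _ _ _ _
  (fun x => 'D_v T x 0 i * 'D_(coord_vec i) f (T x) +
  \sum_(j <- r) 'D_v T x 0 j * 'D_(coord_vec j) f (T x))) => //.
  by move=> x _; rewrite big_cons.
apply: smooth_orderD => //; apply: smooth_orderM => //.
  have /(smooth_on_mxP _ oA)/(_ 0 i)/smooth_orderP := smooth_on_derive v sT.
  exact.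
exact: (IH _ (smooth_on_derive (coord_vec i) sf)).
Qed.

End Composition.

Section DerivativeFormulas.
Context {R : realType} {V : normedModType R}.
Implicit Types A : set V.

Lemma smooth_onB A (f g : V -> R) : open A ->
  smooth_on A f -> smooth_on A g -> smooth_on A (fun x => f x - g x).
Proof.
move=> oA sf sg.
apply: (@eq_smooth_on _ _ _ _ (fun x => f x + cst (-1) x * g x)) => //.
  by move=> x _; rewrite /= mulN1r.
by apply: smooth_onD => //; apply: smooth_onM => //; exact: smooth_on_cst.
Qed.

Lemma smooth_onZ n A (h : V -> R) (f : V -> 'rV[R]_n) : open A ->
  smooth_on A h -> smooth_on A f -> smooth_on A (fun x => h x *: f x).
Proof.
move=> oA sh /(smooth_on_mxP _ oA) sf; apply/(smooth_on_mxP _ oA) => i j.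
apply: (@eq_smooth_on _ _ _ _ (fun x => h x * f x i j)) => //.
  by move=> x _; rewrite mxE.
exact: smooth_onM.
Qed.

Lemma smooth_on_pairing n A (f h : V -> 'rV[R]_n) : open A ->
  smooth_on A f -> smooth_on A h -> smooth_on A (fun x => pairing (f x) (h x)).
Proof.
move=> oA /(smooth_on_mxP _ oA) sf /(smooth_on_mxP _ oA) sh.
by apply: smooth_on_sum => // i _; exact: smooth_onM.
Qed.

Lemma derive_sum_fun n (h : 'I_n -> V -> R) x v :
  (forall i, differentiable (h i) x) ->
  'D_v (fun y => \sum_i h i y) x = \sum_i 'D_v (h i) x.
Proof.
move=> dh; rewrite (_ : (fun y => _) = \sum_i h i); last first.
  by apply/funext => y; rewrite fct_sumE.
by rewrite derive_sum // => i; exact: diff_derivable.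
Qed.

Lemma derive_mul_fun (f h : V -> R) x v :
  differentiable f x -> differentiable h x ->
  'D_v (fun y => f y * h y) x = f x * 'D_v h x + h x * 'D_v f x.
Proof. by move=> df dh; rewrite deriveM //; exact: diff_derivable. Qed.

Lemma smooth_on_dir_derive n (A : set 'rV[R]_n) (X : 'rV[R]_n -> 'rV[R]_n)
  (f : 'rV[R]_n -> R) : open A -> smooth_on A X -> smooth_on A f ->
  smooth_on A (fun x => 'D_(X x) f x).
Proof.
move=> oA sX sf.
pose h x := \sum_i X x 0 i * 'D_(coord_vec i) f x.
apply: (@eq_smooth_on _ _ _ _ h) => //.
  move=> x; rewrite inE => Ax; rewrite derive_coord_sum //.
  exact: smooth_on_differentiable sf Ax.
apply: smooth_on_sum => // i _; apply: smooth_onM => //.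
  exact: ((smooth_on_mxP _ oA).1 sX 0 i).
exact: smooth_on_derive.
Qed.

End DerivativeFormulas.

Section MatrixValued.
Context {R : realType} {V : normedModType R}.
Implicit Types A : set V.

Lemma differentiable_mulmx m n p (F : V -> 'M[R]_(m, n))
    (G : V -> 'M[R]_(n, p)) x :
  differentiable F x -> differentiable G x ->
  differentiable (fun y => F y *m G y) x.
Proof.
move=> dF dG; apply: differentiable_mx => i j.
rewrite (_ : (fun y => _) = \sum_k (fun y => F y i k * G y k j)); last first.
  by apply/funext => y; rewrite mxE fct_sumE.
apply: differentiable_sum => k.
by apply: differentiableM; exact: differentiable_entry.
Qed.

Lemma derive_mulmx m n p (F : V -> 'M[R]_(m, n)) (G : V -> 'M[R]_(n, p)) x v :
  differentiable F x -> differentiable G x ->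
  'D_v (fun y => F y *m G y) x = 'D_v F x *m G x + F x *m 'D_v G x.
Proof.
move=> dF dG; apply/matrixP => i j.
rewrite derive_entry; last exact: differentiable_mulmx.
rewrite (_ : (fun y => _) = (fun y => \sum_k F y i k * G y k j)); last first.
  by apply/funext => y; rewrite mxE.
rewrite derive_sum_fun => [|k]; last first.
  by apply: differentiableM; exact: differentiable_entry.
rewrite !mxE -big_split /=; apply: eq_bigr => k _.
rewrite derive_mul_fun; [|exact: differentiable_entry..].
by rewrite !derive_entry //; ring.
Qed.

Lemma differentiable_trmx m n (F : V -> 'M[R]_(m, n)) x :
  differentiable F x -> differentiable (fun y => (F y)^T) x.
Proof.
move=> dF; apply: differentiable_mx => i j.
rewrite (_ : (fun y => _) = fun y => F y j i).
  exact: differentiable_entry.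
by apply/funext => y; rewrite mxE.
Qed.

Lemma derive_trmx m n (F : V -> 'M[R]_(m, n)) x v :
  differentiable F x -> 'D_v (fun y => (F y)^T) x = ('D_v F x)^T.
Proof.
move=> dF; apply/matrixP => i j.
rewrite derive_entry; last exact: differentiable_trmx.
rewrite mxE derive_entry //; congr ('D_v _ x).
by apply/funext => y; rewrite mxE.
Qed.

Lemma smooth_on_linear {W : normedModType R} A (f : {linear V -> W}) :
  continuous f -> smooth_on A f.
Proof.
move=> cf; have df x : differentiable f x by exact: linear_differentiable.
apply/smooth_orderP; case=> [|k]; first by apply/smooth_order0.
apply/smooth_orderS; split=> // v.
rewrite (_ : 'D_v f = cst (f v)); first by move=> vs x _; exact: smooth_on_cst.
by apply/funext => x; rewrite deriveE // diff_lin.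
Qed.

Lemma smooth_on_id A : smooth_on A (@id V).
Proof. by apply: (@smooth_on_linear V A idfun) => ? //. Qed.

End MatrixValued.

Lemma smooth_on_fst {R : realType} {V V' : normedModType R} (A : set (V * V')) :
  smooth_on A (@fst V V').
Proof. by apply: (@smooth_on_linear _ _ _ _ fst) => z; exact: cvg_fst. Qed.

Lemma smooth_on_snd {R : realType} {V V' : normedModType R} (A : set (V * V')) :
  smooth_on A (@snd V V').
Proof. by apply: (@smooth_on_linear _ _ _ _ snd) => z; exact: cvg_snd. Qed.

(** * Linear algebra *)

Section Pairing.
Context {R : realType}.

Lemma pairingE n (p v : 'rV[R]_n) : pairing p v = (p *m v^T) 0 0.
Proof. by rewrite /pairing mxE; apply: eq_bigr => i _; rewrite mxE. Qed.

Lemma pairingDr n (p v w : 'rV[R]_n) :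
  pairing p (v + w) = pairing p v + pairing p w.
Proof. by rewrite !pairingE linearD mulmxDr mxE. Qed.

Lemma pairingDl n (p v w : 'rV[R]_n) :
  pairing (p + v) w = pairing p w + pairing v w.
Proof. by rewrite !pairingE mulmxDl mxE. Qed.

Lemma pairingZr n (p v : 'rV[R]_n) a : pairing p (a *: v) = a * pairing p v.
Proof. by rewrite !pairingE linearZ -scalemxAr mxE. Qed.

Lemma pairingZl n (p v : 'rV[R]_n) a : pairing (a *: p) v = a * pairing p v.
Proof. by rewrite !pairingE -scalemxAl mxE. Qed.

Lemma pairing_sumr n (p : 'rV[R]_n) I (r : seq I) (v : I -> 'rV[R]_n) :
  pairing p (\sum_(i <- r) v i) = \sum_(i <- r) pairing p (v i).
Proof.
elim: r => [|i r IH]; last by rewrite !big_cons pairingDr IH.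
by rewrite !big_nil pairingE trmx0 mulmx0 mxE.
Qed.

Lemma pairing_coord_vec n (p : 'rV[R]_n) i : pairing p (coord_vec i) = p 0 i.
Proof. by rewrite pairingE trmx_delta -colE mxE. Qed.

End Pairing.

Section LinearAlgebra.
Context {R : realFieldType} {n : nat}.

(** Polarization. *)
Lemma quadratic_form_eq0 (S : 'M[R]_n) : S^T = S ->
  (forall p : 'rV[R]_n, (p *m S *m p^T) 0 0 = 0) -> S = 0.
Proof.
move=> sS S0; apply/matrixP => i j; rewrite [RHS]mxE.
have E (p q : 'rV[R]_n) : (p *m S *m q^T) 0 0 = 0.
  have sE : (q *m S *m p^T) 0 0 = (p *m S *m q^T) 0 0.
    by rewrite -[q *m S *m p^T]trmxK mxE !trmx_mul trmxK sS mulmxA.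
  have := S0 (p + q); rewrite linearD /= !mulmxDl !mulmxDr.
  rewrite mxE [X in X + _]mxE [X in _ + X]mxE !S0 sE; lra.
have := E (delta_mx 0 i) (delta_mx 0 j).
by rewrite -rowE trmx_delta -colE !mxE.
Qed.

(** The uniqueness of the Levi-Civita connection: [E] is the difference of two
    metric torsion-free connections.  Lowering its last index gives a 3-tensor
    which is symmetric in the first two indices and antisymmetric in the last
    two, hence zero. *)
Lemma metric_torsion_free_unique (gm : 'M[R]_n) (E : 'I_n -> 'M[R]_n) :
  gm \in unitmx ->
  (forall i j k, E i j k = E j i k) ->
  (forall i, E i *m gm + (E i *m gm)^T = 0) ->
  forall i, E i = 0.
Proof.
move=> ug symE antiE.
have symT i j k : (E i *m gm) j k = (E j *m gm) i k.
  by rewrite !mxE; apply: eq_bigr => l _; rewrite symE.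
have antiT i j k : (E i *m gm) j k = - (E i *m gm) k j.
  apply/eqP; rewrite -addr_eq0; apply/eqP.
  by have /matrixP/(_ j k) := antiE i; rewrite !mxE.
move=> i; apply: (can_inj (mulmxK ug)); rewrite mul0mx.
apply/matrixP => j k; rewrite [RHS]mxE.
have : (E i *m gm) j k = - (E i *m gm) j k.
  by rewrite {1}symT antiT symT antiT opprK symT antiT.
lra.
Qed.

End LinearAlgebra.

(** The fibrewise algebra of the proof, at a point with Gram matrix [gm].  Here
    [dg i] and [dG i] are the derivatives of the metric and of the cometric,
    [N i] holds the Christoffel symbols, and the connection coefficients on the
    line [t *: p] are [Gam0 i + t *: (p *m K i)].  The last hypothesis is the
    invariance of the quadratic Hamiltonian.  Its part of degree 1 in [t] gives
    [Gam0 i = 0], and its part of degree 2 says that [- (K i)^T] defines a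
    metric connection, which is also torsion-free, like the one defined by
    [N i]. *)
Lemma transport_eq_levi_civita (R : realFieldType) n (gm : 'M[R]_n)
    (dg dG N K : 'I_n -> 'M[R]_n) (Gam0 : 'I_n -> 'rV[R]_n) :
  gm^T = gm -> gm \in unitmx ->
  (forall i, dg i *m invmx gm + gm *m dG i = 0) ->
  (forall i, dg i = N i *m gm + (N i *m gm)^T) ->
  (forall i j k, N i j k = N j i k) ->
  (forall i j k, K i k j = K j k i) ->
  (forall i (p : 'rV[R]_n) (t : R),
     2^-1 * ((t *: p) *m dG i *m (t *: p)^T) 0 0 =
     ((Gam0 i + t *: (p *m K i)) *m invmx gm *m (t *: p)^T) 0 0) ->
  forall i, Gam0 i = 0 /\ K i = - (N i)^T.
Proof.
move=> sg ug dgG dgN symN symK HJ.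
set G := invmx gm in dgG HJ *.
have sG : G^T = G by rewrite /G trmx_inv sg.
have uG : G \in unitmx by rewrite unitmx_inv.
have dgE i : gm *m dG i *m gm = - dg i.
  have /eqP := dgG i; rewrite addrC addr_eq0 => /eqP ->.
  by rewrite mulNmx mulmxKV.
have sdg i : (dg i)^T = dg i by rewrite {1}dgN linearD /= trmxK addrC -dgN.
have sdG i : (dG i)^T = dG i.
  apply: (can_inj (mulKmx ug)); apply: (can_inj (mulmxK ug)).
  rewrite dgE; apply: (can_inj (@trmxK _ _ _)).
  by rewrite !trmx_mul trmxK sg mulmxA dgE linearN /= sdg.
have addE (A B : 'M[R]_1) : (A + B) 0 0 = A 0 0 + B 0 0 by rewrite mxE.
have oppE (A : 'M[R]_1) : (- A) 0 0 = - A 0 0 by rewrite mxE.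
have HJ1 i (p : 'rV[R]_n) : 2^-1 * (p *m dG i *m p^T) 0 0 =
    (Gam0 i *m G *m p^T) 0 0 + (p *m K i *m G *m p^T) 0 0.
  by have := HJ i p 1; rewrite !scale1r !mulmxDl addE.
have HJ2 i (p : 'rV[R]_n) : 2^-1 * (p *m dG i *m p^T) 0 0 =
    - (Gam0 i *m G *m p^T) 0 0 + (p *m K i *m G *m p^T) 0 0.
  have := HJ i p (-1); rewrite !scaleN1r linearN /= !mulmxN !mulNmx opprK.
  by rewrite !mulmxBl oppE addE oppE opprB addrC.
have Gam00 i : Gam0 i = 0.
  apply: (can_inj (mulmxK uG)); rewrite mul0mx; apply/rowP => k.
  have := HJ1 i (delta_mx 0 k); rewrite HJ2 trmx_delta -!colE.
  by rewrite [(col _ _) 0 0]mxE => h; rewrite [RHS]mxE; lra.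
have KE i : dG i = K i *m G + (K i *m G)^T.
  apply/eqP; rewrite -subr_eq0; apply/eqP/quadratic_form_eq0.
    by rewrite linearB /= linearD /= trmxK sdG [_^T + _]addrC.
  move=> p; rewrite mulmxBr mulmxBl mulmxDr mulmxDl.
  have -> : p *m (K i *m G)^T *m p^T = (p *m (K i *m G) *m p^T)^T.
    by rewrite !trmx_mul !trmxK !mulmxA.
  rewrite !mulmxA !addE !oppE addE [(_^T) 0 0]mxE.
  by have := HJ1 i p; rewrite Gam00 !mul0mx [(0 : 'M[R]_1) 0 0]mxE; lra.
(* The difference of the two connections. *)
have E0 := @metric_torsion_free_unique _ _ gm (fun i => N i + (K i)^T) ug.
have {}E0 i : N i + (K i)^T = 0.
  apply: E0 => [{}i j k|{}i]; first by rewrite !mxE symN symK.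
  rewrite mulmxDl linearD /= addrACA -dgN.
  have -> : dg i = - (gm *m dG i *m gm) by rewrite dgE opprK.
  rewrite KE mulmxDr mulmxDl !trmx_mul sG sg !mulmxA mulmxKV //.
  by rewrite mulmxV // mul1mx trmxK [X in _ + X]addrC addNr.
move=> i; split=> //; apply: (can_inj (@trmxK _ _ _)).
by rewrite linearN /= trmxK; apply/eqP; rewrite -addr_eq0 addrC E0.
Qed.

Lemma invmx_congruence (F : fieldType) n (a b S : 'M[F]_n) :
  a *m b = 1%:M -> S \in unitmx ->
  invmx (a *m S *m a^T) = b^T *m invmx S *m b.
Proof.
move=> ab uS; have [ua ub] := mulmx1_unit ab.
have ul : a *m S *m a^T \in unitmx by rewrite !unitmx_mul unitmx_tr ua uS.
apply: (can_inj (mulKmx ul)); rewrite mulmxV // !mulmxA.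
rewrite -(mulmxA (a *m S) a^T) -trmx_mul (mulmx1C ab) trmx1 mulmx1.
by rewrite -(mulmxA a) mulmxV // mulmx1.
Qed.

(** The symmetry of a Lagrangian graph: the hypothesis is the involution of the
    functions whose derivatives are [A] along the base and [B] along the
    fibres. *)
Lemma invmx_mul_sym (K : fieldType) n (A B : 'M[K]_n) : B \in unitmx ->
  A *m B^T = B *m A^T -> (invmx B *m A)^T = invmx B *m A.
Proof.
move=> uB AB; have uBt : B^T \in unitmx by rewrite unitmx_tr.
apply: (can_inj (mulKmx uB)); apply: (can_inj (mulmxK uBt)).
rewrite mulKVmx // AB trmx_mul -mulmxA; congr (_ *m _).
by rewrite -mulmxA -trmx_mul mulmxV // trmx1 mulmx1.
Qed.

Lemma sum_pair (U V : nmodType) I (r : seq I) (p : I -> U) (q : I -> V) :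
  \sum_(i <- r) (p i, q i) = (\sum_(i <- r) p i, \sum_(i <- r) q i).
Proof.
by elim: r => [|i r IH]; rewrite ?big_nil ?big_cons // IH.
Qed.

Lemma sym_mulmx_entry (K : fieldType) n (S : 'M[K]_n) (v : 'rV[K]_n) i :
  S^T = S -> (v *m S) 0 i = (row i S *m v^T) 0 0.
Proof.
move=> /matrixP sS; rewrite !mxE; apply: eq_bigr => j _.
by have := sS i j; rewrite !mxE mulrC => ->.
Qed.

(** * Charts and the metric *)

Section Charts.
Context {R : realType} {n : nat} {M : manifold R n}.
Implicit Types (c d e : chart R n M) (m : M) (x : 'rV[R]_n).

Lemma param_dom c x : topological_chart c -> img c x -> dom c (param c x).
Proof. by move=> [_ _ pK _ _] [m cm <-]; rewrite pK. Qed.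

Lemma paramK c x : topological_chart c -> img c x -> c (param c x) = x.
Proof. by move=> [_ _ pK _ _] [m cm <-]; rewrite pK. Qed.

Lemma overlapE c d : topological_chart c ->
  overlap c d = img c `&` param c @^-1` dom d.
Proof.
move=> tc; apply/seteqP; split=> x /=.
  move=> [m [cm dm] <-]; case: tc => _ _ pK _ _.
  by split; [exists m|rewrite /= pK].
move=> [ix dx]; exists (param c x); last exact: paramK.
by split=> //; exact: param_dom.
Qed.

Lemma open_param_preimage c (B : set M) : topological_chart c -> open B ->
  open (img c `&` param c @^-1` B).
Proof.
move=> [_ oi _ _ ct] oB; rewrite openE => x [ix Bx].
rewrite continuous_open_subspace // in ct.
apply: filterI; first exact: open_nbhs_nbhs.
by apply: (ct x); [rewrite inE|exact: open_nbhs_nbhs].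
Qed.

Lemma overlap_open c d : topological_chart c -> topological_chart d ->
  open (overlap c d).
Proof.
by move=> tc [od _ _ _ _]; rewrite overlapE //; exact: open_param_preimage.
Qed.

Lemma overlap_img c d : overlap c d `<=` img c.
Proof. by move=> x [m [cm _] <-]; exists m. Qed.

Lemma trans_overlap c d x : topological_chart c ->
  overlap c d x -> overlap d c (trans c d x).
Proof.
move=> [_ _ pK _ _] [m [cm dm] <-]; exists m => //.
by rewrite /trans pK.
Qed.

Lemma transK c d x : topological_chart c -> topological_chart d ->
  overlap c d x -> trans d c (trans c d x) = x.
Proof.
by move=> [_ _ pc _ _] [_ _ pd _ _] [m [cm dm] <-]; rewrite /trans pc // pd.
Qed.

Lemma atlas_coordinate_system c : atlas c -> coordinate_system c.
Proof.
move=> ac; split; first exact: atlas_topological.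
by move=> d; exact: atlas_compatible.
Qed.

(** Two coordinate systems are only assumed compatible with the atlas; around
    each point their transition map factors through a reference chart. *)
Lemma trans_smooth c d : coordinate_system c -> coordinate_system d ->
  smooth_on (overlap c d) (trans c d).
Proof.
move=> [tc cc] [td cd]; apply: smooth_on_cover => x oxcd.
have [ix dx] : img c x /\ dom d (param c x).
  by move: oxcd; rewrite overlapE.
pose e := chart_at (param c x).
have ae : atlas e by exact: chart_at_atlas.
have te : topological_chart e by exact: atlas_topological.
pose B := img c `&` param c @^-1` (dom d `&` dom e).
have oB : open B.
  apply: open_param_preimage => //.
  by apply: openI; [case: td|case: te].
exists B; first by split=> //; split=> //; exact: chart_at_dom.
apply/(smooth_on_mxP _ oB) => i j; rewrite (ord1 i).
apply: (@eq_smooth_on _ _ _ _ (fun y => trans e d (trans c e y) 0 j)) => //.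
  move=> y; rewrite inE => -[_ [_ ey]].
  by rewrite /trans; case: te => _ _ -> //.
pose h z := trans e d z 0 j.
apply: (@smooth_on_comp _ _ _ _ (overlap e d) _ h) => //.
- move=> y [iy [dy ey]]; rewrite /trans; exists (param c y) => //.
- have [sce _] := cc _ ae.
  apply: smooth_on_subset sce => y [iy [dy ey]].
  by rewrite overlapE.
- have [_ sed] := cd _ ae.
  exact: ((smooth_on_mxP _ (overlap_open te td)).1 sed 0 j).
Qed.

Lemma jacobian_trans_inv c d x : coordinate_system c -> coordinate_system d ->
  overlap c d x ->
  'J (trans c d) x *m 'J (trans d c) (trans c d x) = 1%:M.
Proof.
move=> hc hd ox; have [tc _] := hc; have [td _] := hd.
apply/row_matrixP => i; rewrite !rowE mulmxA mulmx1.
have d1 : differentiable (trans c d) x.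
  exact: smooth_on_differentiable (trans_smooth hc hd) ox.
have d2 : differentiable (trans d c) (trans c d x).
  exact: smooth_on_differentiable (trans_smooth hd hc) (trans_overlap tc ox).
rewrite -deriveEjacobian // -deriveEjacobian // -derive_comp //.
rewrite (@eq_derive_on _ _ _ (overlap c d) _ id) ?derive_id //.
- exact: overlap_open.
- by move=> y; rewrite inE => /transK ->.
Qed.

Lemma overlap_chart_at c x : topological_chart c -> img c x ->
  overlap c (chart_at (param c x)) x.
Proof.
by move=> tc ix; rewrite overlapE //; split=> //; exact: chart_at_dom.
Qed.

End Charts.

Section LocalMetric.
Context {R : realType} {n : nat} {M : manifold R n} (g : M -> 'M[R]_n).
Hypothesis hg : pseudo_riemannian g.
Variable c : chart R n M.
Hypothesis hc : coordinate_system c.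

Let A x := 'J (trans c (chart_at (param c x))) x.
Let B x :=
  'J (trans (chart_at (param c x)) c) (trans c (chart_at (param c x)) x).

Let AB x : img c x -> A x *m B x = 1%:M.
Proof.
move=> ix; apply: jacobian_trans_inv => //.
  exact/atlas_coordinate_system/chart_at_atlas.
by apply: overlap_chart_at => //; case: hc.
Qed.

Lemma local_metric_unit x : img c x -> local_metric g c x \in unitmx.
Proof.
move=> ix; have [uA _] := mulmx1_unit (AB ix).
by rewrite /local_metric !unitmx_mul unitmx_tr uA (metric_nondegenerate hg).
Qed.

Lemma local_metric_sym x : (local_metric g c x)^T = local_metric g c x.
Proof.
by rewrite /local_metric !trmx_mul trmxK (Defs.metric_sym hg) mulmxA.
Qed.

Lemma invmx_local_metric x : img c x ->
  invmx (local_metric g c x) = (B x)^T *m invmx (g (param c x)) *m B x.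
Proof.
move=> ix; apply: invmx_congruence; [exact: AB|exact: metric_nondegenerate].
Qed.

(** Covectors transform by the inverse transpose of the Jacobian, the Gram
    matrix by the Jacobian, so the two changes of coordinates cancel. *)
Lemma local_geodesic_hamiltonian x p : img c x ->
  local_fun (geodesic_hamiltonian g) c (x, p) =
  2^-1 * (p *m invmx (local_metric g c x) *m p^T) 0 0.
Proof.
move=> ix; rewrite /local_fun /geodesic_hamiltonian /cotangent_trans /=.
by rewrite invmx_local_metric // trmx_mul trmxK !mulmxA.
Qed.

End LocalMetric.

(** * The dual connection *)

Section Connection.
Context {R : realType} {n : nat} {M : manifold R n}.
Variables (nabla : covariant_derivative M).
Hypothesis hn : linear_connection (@tangent_trans R n M) nabla.
Local Notation field := ('rV[R]_n -> 'rV[R]_n).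

Section InChart.
Variables (c : chart R n M) (W : set 'rV[R]_n).
Hypothesis hc : coordinate_system c.
Hypothesis oW : open W.
Hypothesis Wc : W `<=` img c.

Lemma connection0r X x : smooth_on W X -> W x -> nabla c X (cst 0) x = 0.
Proof.
move=> sX Wx.
have s0 : smooth_on W (cst 0 : field) by exact: smooth_on_cst.
have := lc_additive hn hc oW Wc sX s0 s0 Wx.
rewrite (_ : (fun y : 'rV[R]_n => _) = cst 0); last first.
  by apply/funext => y; rewrite addr0.
by move=> /eqP; rewrite -subr_eq0 opprD addrA subrr sub0r oppr_eq0 => /eqP.
Qed.

(** Linearity in the combination [1 *: 0 + 0] reads [nabla_0 = 2 nabla_0]. *)
Lemma connection0l Y x : smooth_on W Y -> W x -> nabla c (cst 0) Y x = 0.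
Proof.
move=> sY Wx.
have s0 : smooth_on W (cst 0 : field) by exact: smooth_on_cst.
have s1 : smooth_on W (cst 1 : 'rV[R]_n -> R) by exact: smooth_on_cst.
have := lc_linear hn hc oW Wc s1 s0 s0 sY Wx.
rewrite (_ : (fun y : 'rV[R]_n => _) = cst 0); last first.
  by apply/funext => y; rewrite /= scaler0 addr0.
rewrite scale1r.
by move=> /eqP; rewrite -subr_eq0 opprD addrA subrr sub0r oppr_eq0 => /eqP.
Qed.

Lemma smooth_frame (r : seq 'I_n) (h : 'I_n -> 'rV[R]_n -> R) :
  (forall i, smooth_on W (h i)) ->
  smooth_on W (fun y => \sum_(i <- r) h i y *: coord_vec i : 'rV[R]_n).
Proof.
move=> sh; apply: smooth_on_sum => // i _.
by apply: smooth_onZ => //; exact: smooth_on_cst.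
Qed.

Lemma connection_suml X Y x : smooth_on W X -> smooth_on W Y -> W x ->
  nabla c X Y x = \sum_i X x 0 i *: nabla c (cst (coord_vec i)) Y x.
Proof.
move=> sX sY Wx.
have sXi i : smooth_on W (fun y => X y 0 i).
  exact: ((smooth_on_mxP _ oW).1 sX 0 i).
have {1}-> : X = (fun y => \sum_i X y 0 i *: coord_vec i).
  by apply/funext => y; exact: row_sum_coord_vec.
elim: (index_enum _) => [|i r IH].
  rewrite big_nil (_ : (fun y => _) = cst 0) ?connection0l //.
  by apply/funext => y; rewrite big_nil.
have sr := smooth_frame r sXi.
rewrite big_cons -IH -(lc_linear hn hc oW Wc (sXi i) _ sr sY Wx) //.
  by congr nabla; apply/funext => y; rewrite big_cons.
exact: smooth_on_cst.
Qed.

Lemma connection_sumr X Y x : smooth_on W X -> smooth_on W Y -> W x ->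
  nabla c X Y x = \sum_i ('D_(X x) (fun y => Y y 0 i) x *: coord_vec i +
                          Y x 0 i *: nabla c X (cst (coord_vec i)) x).
Proof.
move=> sX sY Wx.
have sYi i : smooth_on W (fun y => Y y 0 i).
  exact: ((smooth_on_mxP _ oW).1 sY 0 i).
have {1}-> : Y = (fun y => \sum_i Y y 0 i *: coord_vec i).
  by apply/funext => y; exact: row_sum_coord_vec.
elim: (index_enum _) => [|i r IH].
  rewrite big_nil (_ : (fun y => _) = cst 0) ?connection0r //.
  by apply/funext => y; rewrite big_nil.
have se : smooth_on W (cst (coord_vec i) : field) by exact: smooth_on_cst.
rewrite big_cons -IH -(lc_leibniz hn hc oW Wc (sYi i) sX se Wx).
rewrite -(lc_additive hn hc oW Wc sX _ (smooth_frame r sYi) Wx) //.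
  by congr nabla; apply/funext => y; rewrite big_cons.
exact: smooth_onZ.
Qed.

(** The Leibniz rule that characterizes the dual connection, for arbitrary
    fields instead of the coordinate fields of its definition. *)
Lemma dual_pairing X Y alpha x :
  smooth_on W X -> smooth_on W Y -> smooth_on W alpha -> W x ->
  pairing (dual_connection nabla c X alpha x) (Y x) =
  'D_(X x) (fun y => pairing (alpha y) (Y y)) x -
  pairing (alpha x) (nabla c X Y x).
Proof.
move=> sX sY sa Wx.
have dY i : differentiable (fun y => Y y 0 i) x.
  exact/differentiable_entry/(smooth_on_differentiable sY Wx).
have da i : differentiable (fun y => alpha y 0 i) x.
  exact/differentiable_entry/(smooth_on_differentiable sa Wx).
rewrite (@derive_sum_fun _ _ _ (fun i y => alpha y 0 i * Y y 0 i)); last first.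
  by move=> i; exact: differentiableM.
rewrite (connection_sumr sX sY Wx) pairing_sumr -sumrB /pairing.
apply: eq_bigr => i _; rewrite derive_mul_fun // mxE.
rewrite -!/(pairing _ _) pairingDr !pairingZr pairing_coord_vec; ring.
Qed.

End InChart.

Lemma dual_connection_smooth c W X alpha :
  coordinate_system c -> open W -> W `<=` img c ->
  smooth_on W X -> smooth_on W alpha ->
  smooth_on W (dual_connection nabla c X alpha).
Proof.
move=> hc oW Wc sX sa; apply/(smooth_on_mxP _ oW) => i j.
pose F x := 'D_(X x) (fun y => alpha y 0 j) x
            - pairing (alpha x) (nabla c X (cst (coord_vec j)) x).
apply: (@eq_smooth_on _ _ _ _ F) => //.
  by move=> x _; rewrite mxE.
apply: smooth_onB => //.
  apply: smooth_on_dir_derive => //; exact: ((smooth_on_mxP _ oW).1 sa 0 j).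
apply: smooth_on_pairing => //; apply: (lc_smooth hn) => //.
exact: smooth_on_cst.
Qed.

(** A covector field is determined by its pairings with vector fields, and in
    [dual_pairing] both terms on the right are invariant under changes of
    coordinates.  It is applied to the vector field [Y] that becomes the [j]-th
    coordinate field in the second chart. *)
Lemma dual_connection_natural c d (W : set 'rV[R]_n)
    (X alpha X' alpha' : field) :
  coordinate_system c -> coordinate_system d ->
  open W -> W `<=` overlap c d ->
  smooth_on W X -> smooth_on W alpha ->
  smooth_on (trans c d @` W) X' -> smooth_on (trans c d @` W) alpha' ->
  (forall x, W x -> X' (trans c d x) = tangent_trans c d x (X x)) ->
  (forall x, W x -> alpha' (trans c d x) = cotangent_trans c d x (alpha x)) ->
  forall x, W x -> dual_connection nabla d X' alpha' (trans c d x) =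
                   cotangent_trans c d x (dual_connection nabla c X alpha x).
Proof.
move=> hc hd oW Wcd sX sa sX' sa' XX' aa' x Wx.
have Wc : W `<=` img c by exact: subset_trans (@overlap_img _ _ _ c d).
have [tc _] := hc; have [td _] := hd.
apply/rowP => j.
pose Y y := coord_vec j *m 'J (trans d c) (trans c d y).
have sY : smooth_on W Y.
  have sT : smooth_on W (trans c d).
    exact: smooth_on_subset (trans_smooth hc hd).
  have sT' := trans_smooth hd hc.
  apply/(smooth_on_mxP _ oW) => i k; rewrite (ord1 i).
  apply: (@eq_smooth_on _ _ _ _
    (fun y => 'D_(coord_vec j) (trans d c) (trans c d y) 0 k)) => //.
    move=> y; rewrite inE => Wy; rewrite /Y -deriveEjacobian //.
    apply: smooth_on_differentiable sT' _; apply: trans_overlap => //.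
    exact: Wcd.
  apply: (@smooth_on_comp _ _ _ _ (overlap d c) _
    (fun z => 'D_(coord_vec j) (trans d c) z 0 k)) => //.
    by move=> y /Wcd; exact: trans_overlap.
  have sDT' := smooth_on_derive (coord_vec j) sT'.
  exact: ((smooth_on_mxP _ (overlap_open td tc)).1 sDT' 0 k).
have YY y : W y -> cst (coord_vec j) (trans c d y) = tangent_trans c d y (Y y).
  move=> /Wcd oy; rewrite /= /tangent_trans /Y -mulmxA.
  by rewrite (mulmx1C (jacobian_trans_inv hc hd oy)) mulmx1.
have se : smooth_on (trans c d @` W) (cst (coord_vec j) : field).
  exact: smooth_on_cst.
have AB := jacobian_trans_inv hc hd (Wcd _ Wx).
have pairY y : W y -> pairing (alpha y) (Y y) = alpha' (trans c d y) 0 j.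
  move=> Wy; rewrite aa' // -pairing_coord_vec !pairingE /cotangent_trans /Y.
  by rewrite trmx_mul mulmxA.
rewrite mxE (lc_natural hn hc hd oW Wcd sX sY sX' se XX' YY Wx).
rewrite -pairing_coord_vec.
rewrite [cotangent_trans _ _ _ (dual_connection _ _ _ _ _)]/cotangent_trans.
have -> : pairing (dual_connection nabla c X alpha x *m
      ('J (trans d c) (trans c d x))^T) (coord_vec j) =
    pairing (dual_connection nabla c X alpha x) (Y x).
  by rewrite !pairingE /Y trmx_mul mulmxA.
rewrite (dual_pairing hc oW Wc sX sY sa Wx); congr (_ - _).
  have -> : 'D_(X x) (fun y => pairing (alpha y) (Y y)) x =
            'D_(X x) (fun y => alpha' (trans c d y) 0 j) x.
    by apply: eq_derive_on oW Wx _ => y; rewrite inE; exact: pairY.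
  have dT : differentiable (trans c d) x.
    exact/(smooth_on_differentiable (trans_smooth hc hd))/Wcd.
  have da' : differentiable alpha' (trans c d x).
    by apply: smooth_on_differentiable sa' _; exists x.
  rewrite (@derive_comp _ _ _ _ (trans c d) (fun z => alpha' z 0 j)) //.
    by rewrite deriveEjacobian // XX'.
  exact: differentiable_entry.
rewrite aa' // !pairingE /cotangent_trans /tangent_trans trmx_mul.
by rewrite mulmxA -(mulmxA (alpha x)) -trmx_mul AB trmx1 mulmx1.
Qed.

Lemma dual_linear_connection :
  linear_connection (@cotangent_trans R n M) (dual_connection nabla).
Proof.
split.
- move=> c W X alpha; exact: dual_connection_smooth.
- move=> c W h X X' alpha hc oW Wc sh sX sX' sa x Wx; apply/rowP => j.
  rewrite !mxE (lc_linear hn hc oW Wc sh sX sX' _ Wx); last first.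
    exact: smooth_on_cst.
  rewrite derive_linear_dir; last first.
    exact/differentiable_entry/(smooth_on_differentiable sa Wx).
  rewrite pairingDr pairingZr /GRing.scale /=; ring.
- move=> c W X a a' hc oW Wc sX sa sa' x Wx; apply/rowP => j.
  have da i : differentiable (fun y => a y 0 i) x.
    exact/differentiable_entry/(smooth_on_differentiable sa Wx).
  have da' i : differentiable (fun y => a' y 0 i) x.
    exact/differentiable_entry/(smooth_on_differentiable sa' Wx).
  rewrite !mxE (_ : (fun y => _) = (fun y => a y 0 j) + (fun y => a' y 0 j)).
    rewrite deriveD; [|exact: diff_derivable..].
    rewrite pairingDl; ring.
  by apply/funext => y; rewrite mxE.
- move=> c W h X a hc oW Wc sh sX sa x Wx; apply/rowP => j.
  have da : differentiable (fun y => a y 0 j) x.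
    exact/differentiable_entry/(smooth_on_differentiable sa Wx).
  have dh : differentiable h x by exact: smooth_on_differentiable sh Wx.
  rewrite !mxE (_ : (fun y => _) = (fun y => h y * a y 0 j)).
    rewrite derive_mul_fun // pairingZl; ring.
  by apply/funext => y; rewrite mxE.
- exact: dual_connection_natural.
Qed.

End Connection.

(** * Flat linearization *)

Section Flatness.
Context {R : realType} {n : nat}.
Local Notation phase := ('rV[R]_n * 'rV[R]_n)%type.
Variables (O : set phase) (hor : phase -> set phase) (Gam : phase -> 'M[R]_n).
Hypothesis oO : open O.
Hypothesis sGam : forall i j, smooth_on O (fun z => Gam z i j).
Hypothesis horE : forall z, O z -> hor z = [set u | u.2 = - (u.1 *m Gam z)].

(** The vertical component along the graph of [- Gam]. *)
Lemma kappaE z u : O z -> kappa hor z u = u.2 + u.1 *m Gam z.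
Proof.
move=> Oz; rewrite /kappa horE //; apply: xget_unique => [|w] /=.
  by rewrite subr0 opprD addrA subrr add0r.
rewrite subr0 => /eqP; rewrite subr_eq => /eqP ->.
by rewrite addrAC addNr add0r.
Qed.

Lemma kappa0 z : O z -> kappa hor z 0 = 0.
Proof.
by move=> Oz; rewrite (kappaE (0, 0)) //= mul0mx addr0.
Qed.

Lemma kappa_vertical z w : O z -> kappa hor z (0, w) = w.
Proof. by move=> Oz; rewrite kappaE //= mul0mx addr0. Qed.

Lemma smooth_row_connection (v : 'rV[R]_n) : smooth_on O (fun z => v *m Gam z).
Proof.
apply/(smooth_on_mxP _ oO) => i j.
apply: (@smooth_on_mulmx _ _ _ _ _ O (cst v) Gam) => // k l.
exact: smooth_on_cst.
Qed.

Lemma hprojE (u : phase) z : O z ->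
  hproj hor (cst u) z = (u.1, - (u.1 *m Gam z)).
Proof.
move=> Oz; rewrite /hproj /vproj /vlift kappaE //.
by congr pair; rewrite /= ?subr0 // opprD addrA subrr add0r.
Qed.

(** The covariant derivative of a constant form along the horizontal lift of
    [v]: the coordinate expression of the linearized connection. *)
Lemma linearized_horizontal (v q : 'rV[R]_n) z : O z ->
  linearized hor (cst (v, 0)) (cst q) z =
  'D_(0, q) (fun y => v *m Gam y) z.
Proof.
move=> Oz; rewrite /linearized derive_cst addr0 /lie_bracket.
rewrite [vlift _](_ : _ = cst (0, q)) // derive_cst sub0r kappaE //=.
have dG : differentiable (fun y => v *m Gam y) z.
  exact: smooth_on_differentiable (smooth_row_connection v) Oz.
rewrite (@eq_derive_on _ _ _ O _ (fun y => (v, - (v *m Gam y)))) //; last first.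
  by move=> y; rewrite inE => /hprojE ->.
rewrite (@derive_pair _ _ _ _ (cst v)) //; last exact: differentiableN.
rewrite derive_cst /= oppr0 mul0mx addr0.
rewrite (_ : (fun y => - _) = - (fun y => v *m Gam y)) // deriveN ?opprK //.
exact: diff_derivable.
Qed.

Lemma linearized_vertical (q : 'rV[R]_n) (alpha : phase -> 'rV[R]_n) z : O z ->
  linearized hor (cst (0, q)) alpha z = 'D_(0, q) alpha z.
Proof.
move=> Oz; rewrite /linearized /lie_bracket.
have h0 : {in O, hproj hor (cst (0, q)) =1 cst 0}.
  by move=> y; rewrite inE => Oy; rewrite hprojE //= mul0mx oppr0.
rewrite h0 ?inE // derive0 (eq_derive_on _ oO Oz h0) derive_cst subr0.
by rewrite kappa0 // add0r /vproj /vlift /= kappa_vertical.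
Qed.

(** For the constant fields [(0, p)] and [(v, 0)] and the constant form [p], the
    curvature reduces to the second derivative of the connection coefficients
    along the fibre: the fields commute, and [p] is parallel along the first
    one. *)
Lemma flat_second_derivative (v p : 'rV[R]_n) z : O z ->
  curvature hor (cst (0, p)) (cst (v, 0)) (cst p) z = 0 ->
  'D_(0, p) ('D_(0, p) (fun y => v *m Gam y)) z = 0.
Proof.
move=> Oz; rewrite /curvature.
rewrite linearized_vertical //.
have E1 : {in O, linearized hor (cst (v, 0)) (cst p) =1
    'D_(0, p) (fun y => v *m Gam y)}.
  by move=> y; rewrite inE => Oy; rewrite linearized_horizontal.
rewrite (eq_derive_on _ oO Oz E1).
have -> : lie_bracket (cst (0, p) : phase -> phase) (cst (v, 0)) = cst (0, 0).
  by apply/funext => y; rewrite /lie_bracket !derive_cst subrr.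
rewrite linearized_vertical // derive_cst subr0.
have E2 : {in O, linearized hor (cst (0, p)) (cst p) =1 cst 0}.
  by move=> y; rewrite inE => Oy; rewrite linearized_vertical // derive_cst.
suff -> :
    linearized hor (cst (v, 0)) (linearized hor (cst (0, p)) (cst p)) z = 0.
  by rewrite subr0.
set beta := linearized hor (cst (0, p)) (cst p) in E2 *.
have E3 : {in O, vlift beta =1 cst 0}.
  by move=> y Oy; rewrite /vlift E2.
rewrite /linearized /lie_bracket (eq_derive_on _ oO Oz E3) derive_cst.
rewrite E3 ?inE // derive0 (eq_derive_on _ oO Oz E2) derive_cst subrr addr0.
exact: kappa0.
Qed.

End Flatness.

(** * The integrable system in a chart *)

Section IntegrableSystem.
Context {R : realType} {n : nat} {M : manifold R n}.
Variables (g : M -> 'M[R]_n) (f : 'I_n -> cotangent M -> R).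
Hypothesis hg : pseudo_riemannian g.
Hypothesis hf : completely_integrable (geodesic_hamiltonian g) f.
Hypothesis htrans : transversality f.
Variable c : chart R n M.
Hypothesis hc : coordinate_system c.
Local Notation phase := ('rV[R]_n * 'rV[R]_n)%type.
Local Notation O := (phase_img c).
Local Notation H := (local_fun (geodesic_hamiltonian g) c).
Local Notation F i := (local_fun (f i) c).
Local Notation gm := (local_metric g c).

Let tc : topological_chart c. Proof. by case: hc. Qed.

Lemma open_img : open (img c). Proof. by case: tc. Qed.

Lemma open_phase_img : open O.
Proof.
apply: (@open_comp _ _ fst (img c)); last exact: open_img.
by move=> z _; exact: cvg_fst.
Qed.

Definition base_derivatives z := \matrix_(i < n, j < n) d_x j (F i) z.
Definition fibre_derivatives z := \matrix_(i < n, j < n) d_p j (F i) z.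

Let base_derivativesE z i j : base_derivatives z i j = d_x j (F i) z.
Proof. exact: mxE. Qed.
Let fibre_derivativesE z i j : fibre_derivatives z i j = d_p j (F i) z.
Proof. exact: mxE. Qed.
Let trmxE (A : 'M[R]_n) i j : A^T i j = A j i. Proof. exact: mxE. Qed.

(** The coefficients of the nonlinear connection: the horizontal lift of
    [coord_vec i] is [(coord_vec i, - row i (connection_mx z))]. *)
Definition connection_mx z := invmx (fibre_derivatives z) *m base_derivatives z.

Lemma fibre_derivatives_unit z : O z -> fibre_derivatives z \in unitmx.
Proof. exact: htrans. Qed.

Lemma connection_mx_smooth i j : smooth_on O (fun z => connection_mx z i j).
Proof.
have oO := open_phase_img.
have sF k u : smooth_on O ('D_u (F k)) by apply/smooth_on_derive/(ci_smooth hf).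
apply: smooth_on_mulmx => //= k l.
  apply: smooth_on_invmx => //= [z|k' l']; first exact: fibre_derivatives_unit.
  apply: eq_smooth_on oO _ (sF k' (0, coord_vec l')) => z _.
  by rewrite mxE.
by apply: eq_smooth_on oO _ (sF k (coord_vec l, 0)) => z _; rewrite mxE.
Qed.

(** The Hamiltonian fields of functions in involution span a Lagrangian
    subspace, and a Lagrangian graph has a symmetric matrix. *)
Lemma connection_mx_sym z : O z -> (connection_mx z)^T = connection_mx z.
Proof.
move=> Oz; have uB := fibre_derivatives_unit Oz.
have AB : base_derivatives z *m (fibre_derivatives z)^T =
          fibre_derivatives z *m (base_derivatives z)^T.
  apply/matrixP => i j; rewrite [LHS]mxE [RHS]mxE.
  have := ci_involution hf i j hc Oz; rewrite /poisson sumrB => /eqP.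
  rewrite subr_eq0 => /eqP E.
  transitivity (\sum_k d_x k (F i) z * d_p k (F j) z).
    apply: eq_bigr => k _.
    by rewrite base_derivativesE trmxE fibre_derivativesE.
  rewrite E; apply: eq_bigr => k _.
  by rewrite fibre_derivativesE trmxE base_derivativesE.
exact: invmx_mul_sym.
Qed.

Lemma hamiltonian_span (z : phase) (a : 'I_n -> R) :
  \sum_i a i *: hamiltonian_field (F i) z =
  ((\row_i a i) *m fibre_derivatives z, - ((\row_i a i) *m base_derivatives z)).
Proof.
pose P i : 'rV[R]_n := \row_j d_p j (F i) z.
pose Q i : 'rV[R]_n := \row_j - d_x j (F i) z.
transitivity (\sum_i (a i *: P i, a i *: Q i)); first exact: eq_bigr.
rewrite sum_pair; congr pair; apply/rowP => j.
  rewrite summxE [RHS]mxE; apply: eq_bigr => i _.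
  by rewrite fibre_derivativesE 2!mxE [X in _ = X * _]mxE.
rewrite summxE [RHS]mxE [X in - X]mxE -sumrN; apply: eq_bigr => i _.
by rewrite base_derivativesE 2!mxE [X in _ = - (X * _)]mxE mulrN.
Qed.

Lemma integrable_horE z : O z ->
  integrable_hor f c z = [set u | u.2 = - (u.1 *m connection_mx z)].
Proof.
move=> Oz; have uB := fibre_derivatives_unit Oz.
apply/seteqP; split=> [u [a ->]|[v w] /= ->].
  rewrite hamiltonian_span /= /connection_mx.
  move: (fibre_derivatives z) (base_derivatives z) uB => B A uB.
  by rewrite mulmxA mulmxK.
exists (fun i => (v *m invmx (fibre_derivatives z)) 0 i).
rewrite hamiltonian_span.
have -> : \row_i (v *m invmx (fibre_derivatives z)) 0 i =
          v *m invmx (fibre_derivatives z).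
  by apply/rowP => i; rewrite mxE.
rewrite /connection_mx.
move: (fibre_derivatives z) (base_derivatives z) uB => B A uB.
by rewrite mulmxA mulmxKV.
Qed.

(** The Hamiltonian is constant along horizontal curves, because dH is a
    combination of the df_i, which vanish on the horizontal vectors. *)
Lemma hamiltonian_transport z : O z ->
  \row_j d_x j H z = (\row_j d_p j H z) *m connection_mx z.
Proof.
move=> Oz; have uB := fibre_derivatives_unit Oz.
have [a aE] := ci_dependent hf hc Oz.
have Ex : \row_j d_x j H z = (\row_i a i) *m base_derivatives z.
  apply/rowP => j; rewrite mxE [RHS]mxE.
  transitivity (\sum_i a i * d_x j (F i) z); first exact: aE.
  by apply: eq_bigr => i _; rewrite base_derivativesE mxE.
have Ep : \row_j d_p j H z = (\row_i a i) *m fibre_derivatives z.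
  apply/rowP => j; rewrite mxE [RHS]mxE.
  transitivity (\sum_i a i * d_p j (F i) z); first exact: aE.
  by apply: eq_bigr => i _; rewrite fibre_derivativesE mxE.
apply: (etrans Ex); apply: (etrans _ (congr1 (mulmx^~ _) (esym Ep))).
rewrite /connection_mx.
move: (fibre_derivatives z) (base_derivatives z) uB => B A uB.
by rewrite mulmxA mulmxK.
Qed.

Lemma local_metric_smooth : smooth_on (img c) gm.
Proof. exact: metric_smooth. Qed.

Lemma local_cometric_differentiable x : img c x ->
  differentiable (fun y => invmx (gm y)) x.
Proof.
move=> ix; apply: differentiable_mx => i j.
apply: smooth_on_differentiable ix.
apply: smooth_on_invmx open_img _ _ i j; first exact: local_metric_unit.
by apply/(smooth_on_mxP _ open_img); exact: local_metric_smooth.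
Qed.

Lemma d_x_hamiltonian i x p : img c x ->
  d_x i H (x, p) =
  2^-1 * (p *m 'D_(coord_vec i) (fun y => invmx (gm y)) x *m p^T) 0 0.
Proof.
move=> ix; rewrite /d_x derive_fst_dir.
have dG := local_cometric_differentiable ix.
have dpG : differentiable (fun y => p *m invmx (gm y)) x.
  by apply: differentiable_mulmx => //; exact: differentiable_cst.
have dq : differentiable (fun y => p *m invmx (gm y) *m p^T) x.
  by apply: differentiable_mulmx => //; exact: differentiable_cst.
rewrite (@eq_derive_on _ _ _ (img c) _
  (fun y => 2^-1 *: (p *m invmx (gm y) *m p^T) 0 0)) //; last 2 first.
- exact: open_img.
- by move=> y; rewrite inE => iy; rewrite local_geodesic_hamiltonian.
rewrite deriveZ; last exact/diff_derivable/differentiable_entry.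
rewrite -derive_entry // !derive_mulmx //.
by rewrite !derive_cst mul0mx mulmx0 add0r addr0.
Qed.

Lemma d_p_hamiltonian x p : img c x ->
  \row_j d_p j H (x, p) = p *m invmx (gm x).
Proof.
move=> ix; apply/rowP => j; rewrite mxE /d_p derive_snd_dir.
set G := invmx (gm x).
have sG : G^T = G by rewrite /G trmx_inv local_metric_sym.
have dq : differentiable (fun q : 'rV[R]_n => q *m G) p.
  by apply: differentiable_mulmx => //; exact: differentiable_cst.
have dt : differentiable (fun q : 'rV[R]_n => q^T) p.
  exact: (@differentiable_trmx _ _ _ _ id).
rewrite (_ : (fun q => _) = (fun q => 2^-1 *: (q *m G *m q^T) 0 0)); last first.
  by apply/funext => q; rewrite local_geodesic_hamiltonian.
have dqq := differentiable_mulmx dq dt.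
rewrite deriveZ; last exact/diff_derivable/differentiable_entry.
rewrite -derive_entry // derive_mulmx //.
rewrite (@derive_mulmx _ _ _ _ _ id (cst G)) //.
rewrite (@derive_trmx _ _ _ _ id) // derive_id derive_cst mulmx0 addr0.
rewrite trmx_delta -colE mxE [X in _ + X]mxE.
rewrite -[(coord_vec j *m G *m p^T)]trmxK [(_^T) 0 0]mxE !trmx_mul trmxK sG.
rewrite trmx_delta mulmxA -colE [(col _ _) 0 0]mxE /GRing.scale /=; lra.
Qed.

Lemma hamilton_jacobi_transport x p i : img c x ->
  2^-1 * (p *m 'D_(coord_vec i) (fun y => invmx (gm y)) x *m p^T) 0 0 =
  (row i (connection_mx (x, p)) *m invmx (gm x) *m p^T) 0 0.
Proof.
move=> ix; rewrite -d_x_hamiltonian //.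
have Oz : O (x, p) by [].
have /rowP/(_ i) := hamiltonian_transport Oz; rewrite mxE => ->.
rewrite d_p_hamiltonian // (sym_mulmx_entry _ _ (connection_mx_sym Oz)).
by rewrite trmx_mul trmx_inv local_metric_sym // mulmxA.
Qed.

Section Flat.
Hypothesis hflat : linearization_flat (integrable_hor f).

Let inO x p : img c x -> O (x, p). Proof. by []. Qed.

(** The derivative along the fibre of row [i] of [connection_mx], at the zero
    section; [p *m fibre_slope x i] is its value in the direction [p]. *)
Definition fibre_slope x i := \matrix_(l < n, j < n)
  'D_((0, coord_vec l) : phase) (fun z => connection_mx z i j) (x, 0).

(** Flatness is applied at every point of the line [t *: p] to the constant
    fields [(0, p)] and [(coord_vec i, 0)] and the constant form [p]. *)
Lemma connection_mx_affine x (p : 'rV[R]_n) t i : img c x ->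
  row i (connection_mx (x, t *: p)) =
  row i (connection_mx (x, 0)) + t *: (p *m fibre_slope x i).
Proof.
move=> ix; have oO := open_phase_img.
have sGam := connection_mx_smooth; have hE := integrable_horE.
apply/rowP => j; pose h z := connection_mx z i j.
have sh : smooth_on O h by exact: connection_mx_smooth.
pose u : phase := (0, p).
have hrow : h = fun z => (coord_vec i *m connection_mx z) 0 j.
  by apply/funext => z; rewrite -rowE mxE.
have srow := smooth_row_connection oO sGam (coord_vec i).
have Drow : {in O, 'D_u h =1
    fun z => 'D_u (fun y => coord_vec i *m connection_mx y) z 0 j}.
  move=> z; rewrite inE => Oz; rewrite derive_entry -?hrow //.
  exact: smooth_on_differentiable srow Oz.
have zt s : (x, 0) + s *: u = (x, s *: p) :> phase.
  by congr pair; rewrite /= ?scaler0 ?addr0 ?add0r.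
have := @affine_along_line _ _ h (x, 0) u.
have dh s : differentiable h ((x, 0) + s *: u).
  by rewrite zt; apply: smooth_on_differentiable sh _; exact: inO.
have dDh s : differentiable ('D_u h) ((x, 0) + s *: u).
  rewrite zt; apply: (@smooth_on_differentiable _ _ _ O); last exact: inO.
  exact: smooth_on_derive.
move=> /(_ dh dDh) aff.
have hl : h (x, t *: p) = h (x, 0) + t * 'D_u h (x, 0).
  rewrite -zt; apply: aff => s; rewrite zt.
  have Oz : O (x, s *: p) by exact: inO.
  rewrite (eq_derive_on _ oO Oz Drow) -derive_entry; last first.
    exact: smooth_on_differentiable (smooth_on_derive _ srow) Oz.
  rewrite (flat_second_derivative oO sGam hE Oz) ?mxE //.
  by apply: hflat Oz => //; exact: smooth_on_cst.
rewrite [LHS]mxE -/(h _) hl [RHS]mxE [row _ _ 0 j]mxE -/(h _); congr (_ + _).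
rewrite mxE; congr (_ * _).
have dh0 : differentiable h (x, 0) by have := dh 0; rewrite zt scale0r.
rewrite deriveE // mxE.
have -> : u = \sum_l p 0 l *: ((0, coord_vec l) : phase).
  transitivity (\sum_l ((0, p 0 l *: coord_vec l) : phase)).
    by rewrite sum_pair big1 // -row_sum_coord_vec.
  by apply: eq_bigr => l _; congr pair; rewrite /= scaler0.
rewrite linear_sum; apply: eq_bigr => l _; rewrite linearZ mxE.
by rewrite deriveE.
Qed.

Variable nabla : covariant_derivative M.
Hypothesis hnabla : levi_civita g nabla.

Let img_refl : img c `<=` img c. Proof. by []. Qed.

Definition christoffel_mx x i :=
  \matrix_(j < n, k < n) christoffel nabla c i j k x.

Lemma christoffel_sym x i j k : img c x ->
  christoffel nabla c i j k x = christoffel nabla c j i k x.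
Proof.
move=> ix.
have sc (w : 'rV[R]_n) : smooth_on (img c) (cst w : 'rV[R]_n -> 'rV[R]_n).
  exact: smooth_on_cst.
have := lc_torsion_free hnabla hc open_img img_refl
  (sc (coord_vec i)) (sc (coord_vec j)) ix.
rewrite /lie_bracket !derive_cst subrr => /eqP; rewrite subr_eq0 => /eqP E.
by rewrite /christoffel E.
Qed.

(** Compatibility of [nabla] with the metric, for the coordinate fields. *)
Lemma local_metric_derive x i : img c x ->
  'D_(coord_vec i) gm x =
  christoffel_mx x i *m gm x + (christoffel_mx x i *m gm x)^T.
Proof.
move=> ix.
have sc (w : 'rV[R]_n) : smooth_on (img c) (cst w : 'rV[R]_n -> 'rV[R]_n).
  exact: smooth_on_cst.
have dg : differentiable gm x.
  exact: smooth_on_differentiable local_metric_smooth ix.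
have nablaE j : nabla c (cst (coord_vec i)) (cst (coord_vec j)) x =
    row j (christoffel_mx x i).
  by apply/rowP => k; rewrite !mxE.
apply/matrixP => j k; rewrite derive_entry // [RHS]mxE [(_^T) j k]mxE.
have := lc_metric hnabla hc open_img img_refl
  (sc (coord_vec i)) (sc (coord_vec j)) (sc (coord_vec k)) ix.
rewrite /inner /cst !nablaE => E.
have innerE (A : 'M[R]_n) a b :
    (coord_vec a *m A *m (coord_vec b)^T) 0 0 = A a b.
  by rewrite trmx_delta -rowE -colE !mxE.
rewrite (_ : (fun y => _) = (fun y => gm y j k)) in E; last first.
  by apply/funext => y; rewrite innerE.
rewrite E; congr (_ + _).
  by rewrite -row_mul trmx_delta -colE [LHS]mxE mxE.
have -> : coord_vec j *m gm x *m (row k (christoffel_mx x i))^T =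
          (row k (christoffel_mx x i) *m gm x *m (coord_vec j)^T)^T.
  by rewrite 2!trmx_mul trmxK local_metric_sym // mulmxA.
by rewrite mxE -row_mul trmx_delta -colE [LHS]mxE mxE.
Qed.

Lemma connection_mx_christoffel x p i : img c x ->
  row i (connection_mx (x, p)) = - (p *m (christoffel_mx x i)^T).
Proof.
move=> ix.
have dG : forall j, 'D_(coord_vec j) gm x *m invmx (gm x) +
    gm x *m 'D_(coord_vec j) (fun y => invmx (gm y)) x = 0.
  move=> j; rewrite -derive_mulmx; last 2 first.
  - exact: smooth_on_differentiable local_metric_smooth ix.
  - exact: local_cometric_differentiable.
  have E : {in img c, (fun y => gm y *m invmx (gm y)) =1 cst 1%:M}.
    by move=> y; rewrite inE => iy; rewrite mulmxV // local_metric_unit.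
  by rewrite (eq_derive_on _ open_img ix E) derive_cst.
have sN j k l : christoffel_mx x j k l = christoffel_mx x k j l.
  by rewrite mxE [RHS]mxE christoffel_sym.
have sK j k l : fibre_slope x j l k = fibre_slope x k l j.
  rewrite mxE [RHS]mxE; apply: eq_derive_on open_phase_img _ _ => //.
  move=> z; rewrite inE => /connection_mx_sym {1}<-.
  by rewrite mxE.
have HJ j (q : 'rV[R]_n) (t : R) :
    2^-1 * ((t *: q) *m 'D_(coord_vec j) (fun y => invmx (gm y)) x *m
            (t *: q)^T) 0 0 =
    ((row j (connection_mx (x, 0)) + t *: (q *m fibre_slope x j)) *m
     invmx (gm x) *m (t *: q)^T) 0 0.
  by rewrite hamilton_jacobi_transport // connection_mx_affine.
have [G0 KE] := transport_eq_levi_civita (local_metric_sym hg c x)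
  (local_metric_unit hg hc ix) dG (fun j => local_metric_derive j ix)
  sN sK HJ i.
by have := connection_mx_affine p 1 i ix; rewrite !scale1r G0 KE add0r mulmxN.
Qed.

Lemma connection_mx_pairing x p v j : img c x ->
  (v *m connection_mx (x, p)) 0 j =
  - pairing p (nabla c (cst v) (cst (coord_vec j)) x).
Proof.
move=> ix; have oi := open_img; have hn := lc_connection hnabla.
rewrite (connection_suml hn hc oi img_refl _ _ ix); try exact: smooth_on_cst.
rewrite pairing_sumr -sumrN mxE; apply: eq_bigr => i _.
have -> : connection_mx (x, p) i j = row i (connection_mx (x, p)) 0 j.
  by rewrite [RHS]mxE.
rewrite connection_mx_christoffel // pairingZr mxE mulrN; congr (- (_ * _)).
rewrite mxE; apply: eq_bigr => k _; congr (_ * _).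
by rewrite [LHS]mxE [LHS]mxE.
Qed.

(** A horizontal vector of the dual connection is realized by a form that is
    affine in the coordinates, with slope [- connection_mx (x, p)]. *)
Lemma linear_horE z : O z ->
  linear_hor (dual_connection nabla) c z =
  [set u | u.2 = - (u.1 *m connection_mx z)].
Proof.
case: z => x p Oz; have ix : img c x by []; have oi := open_img.
apply/seteqP; split=> [[v w] /= [alpha [sa ax D0 /= ->]]|[v w] /= ->].
  have da := smooth_on_differentiable sa ix.
  apply/rowP => j; rewrite mxE connection_mx_pairing // opprK derive_entry //.
  move/rowP/(_ j) : D0; rewrite mxE [RHS]mxE => /eqP; rewrite subr_eq0 => /eqP.
  by rewrite ax.
pose Q := - connection_mx (x, p).
exists (fun y => (p - x *m Q) + y *m Q).
have sl : smooth_on (img c) (fun y : 'rV[R]_n => y *m Q).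
  apply/(smooth_on_mxP _ oi) => i j.
  apply: (@smooth_on_mulmx _ _ _ _ _ (img c) id (cst Q)) => // k l.
    exact: ((smooth_on_mxP _ oi).1 (@smooth_on_id _ _ (img c)) k l).
  exact: smooth_on_cst.
have sa : smooth_on (img c) (fun y => (p - x *m Q) + y *m Q).
  by apply: smooth_onD => //; exact: smooth_on_cst.
have Da : 'D_v (fun y => (p - x *m Q) + y *m Q) x =
          - (v *m connection_mx (x, p)).
  rewrite (@deriveD _ _ _ (cst (p - x *m Q)) (fun y => y *m Q)); last 2 first.
  - exact: derivable_cst.
  - exact/diff_derivable/(smooth_on_differentiable sl ix).
  rewrite derive_cst add0r (@derive_mulmx _ _ _ _ _ id (cst Q)) //.
  by rewrite derive_id derive_cst mulmx0 addr0 mulmxN.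
split=> //; first by rewrite /= subrK.
apply/rowP => j; rewrite mxE [RHS]mxE -derive_entry; last first.
  exact: smooth_on_differentiable sa ix.
by rewrite Da mxE connection_mx_pairing // opprK subrK subrr.
Qed.

Section Affine.
Hypothesis haff : forall i j k x, img c x -> christoffel nabla c i j k x = 0.

Lemma connection_mx_affine_chart x p : img c x -> connection_mx (x, p) = 0.
Proof.
move=> ix; apply/row_matrixP => i; rewrite connection_mx_christoffel // row0.
rewrite (_ : christoffel_mx x i = 0) ?trmx0 ?mulmx0 ?oppr0 //.
by apply/matrixP => j k; rewrite mxE [RHS]mxE haff.
Qed.

Lemma affine_ignorable i : ignorable (geodesic_hamiltonian g) c i.
Proof.
move=> [x p] Oz; have ix : img c x by [].
have /rowP/(_ i) := hamiltonian_transport Oz.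
by rewrite connection_mx_affine_chart // mulmx0 mxE [RHS]mxE.
Qed.

Lemma gradient_pairing (l x : 'rV[R]_n) : gradient (pairing l) x = l.
Proof.
apply/rowP => i; rewrite mxE /pairing.
rewrite (@derive_sum_fun _ _ _ (fun j (y : 'rV[R]_n) => l 0 j * y 0 j)) => [|j].
  rewrite (bigD1 i) //= big1 => [|j ji].
    rewrite derive_mul_fun //; last exact: differentiable_coord.
    rewrite (@derive_cst _ _ _ (l 0 i)) mulr0 addr0.
    rewrite -(@derive_entry _ _ _ _ id) // derive_id !mxE !eqxx.
    by rewrite mulr1 addr0.
  rewrite derive_mul_fun //; last exact: differentiable_coord.
  rewrite (@derive_cst _ _ _ (l 0 j)) mulr0 addr0.
  rewrite -(@derive_entry _ _ _ _ id) // derive_id !mxE (negbTE ji).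
  by rewrite andbF mulr0.
by apply: differentiableM => //; exact: differentiable_coord.
Qed.

Lemma smooth_pairing (l : 'rV[R]_n) A : open A -> smooth_on A (pairing l).
Proof.
move=> oA; apply: (@smooth_on_pairing _ _ _ _ (cst l) id) => //.
  exact: smooth_on_cst.
exact: smooth_on_id.
Qed.

(** The parameter [l] is the constant momentum of the solution [pairing l], so
    the leaves are the sets where the momentum is [l], and the label of a
    covector is its momentum. *)
Lemma affine_separable : separable (geodesic_hamiltonian g) c.
Proof.
have oi := open_img.
exists setT, (fun l => pairing l); split; last first.
  move=> l _; exists (fun i t => l 0 i * t); split=> // i.
  apply: (@smooth_on_subset _ _ _ _ setT) => //.
  apply: smooth_onM; first exact: openT.
    exact: smooth_on_cst.
  exact: smooth_on_id.
split.
- exact: openT.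
- by move=> l _; exact: smooth_pairing.
- move=> l _; rewrite (_ : gradient _ = cst l); last first.
    by apply/funext => x; exact: gradient_pairing.
  split; first exact: smooth_on_cst.
    by move=> x i j _; rewrite !derive_cst.
  move=> A Ai cA x y Ax Ay /=.
  have HE : {in img c, (fun y => local_fun (geodesic_hamiltonian g) c (y, l)) =1
      fun y => 2^-1 *: (l *m invmx (gm y) *m l^T) 0 0}.
    by move=> z; rewrite inE => iz; rewrite local_geodesic_hamiltonian.
  have dH z : img c z -> differentiable (fun y => H (y, l)) z.
    move=> iz; apply: (eq_differentiable_on oi iz (f := fun y =>
      2^-1 *: (l *m invmx (gm y) *m l^T) 0 0)).
      by move=> w /HE.
    apply: differentiableZ; apply: differentiable_entry.
    apply: differentiable_mulmx; last exact: differentiable_cst.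
    apply: differentiable_mulmx; first exact: differentiable_cst.
    exact: local_cometric_differentiable.
  apply: (derive0_connected_cst oi dH _ Ai cA Ax Ay) => z v iz.
  rewrite derive_coord_sum; last exact: dH.
  rewrite big1 // => i _; rewrite -derive_fst_dir.
  by rewrite -/(d_x i H (z, l)) affine_ignorable // scaler0.
- rewrite (_ : (fun lx : phase => _) = fst).
    exact: smooth_on_fst.
  by apply/funext => -[l x]; exact: gradient_pairing.
- exists snd; split.
  + exact: smooth_on_snd.
  + by move=> z _; split=> //; exact: gradient_pairing.
  + by move=> l x _ _; exact: gradient_pairing.
Qed.

End Affine.

End Flat.

End IntegrableSystem.

Theorem theorem6p6 (R : realType) (n : nat) (M : manifold R n)
    (g : M -> 'M[R]_n) (nabla : covariant_derivative M)
    (f : 'I_n -> cotangent M -> R)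
    (hg : pseudo_riemannian g)
    (hnabla : levi_civita g nabla)
    (hf : completely_integrable (geodesic_hamiltonian g) f)
    (htrans : transversality f)
    (hflat : linearization_flat (integrable_hor f)) :
  [/\ is_linear (integrable_hor f) /\
      same_distribution (integrable_hor f) (linear_hor (dual_connection nabla)),
      (forall c : chart R n M, affine_coordinates nabla c ->
         separable (geodesic_hamiltonian g) c)
    & (forall c : chart R n M, affine_coordinates nabla c ->
         forall i : 'I_n, ignorable (geodesic_hamiltonian g) c i)].
Proof.
have hor c z : coordinate_system c -> phase_img c z ->
    integrable_hor f c z = linear_hor (dual_connection nabla) c z.
  move=> hc Oz; rewrite (integrable_horE htrans hc Oz).
  by rewrite (linear_horE hg hf htrans hc hflat hnabla Oz).
split; first (split; last exact: hor).
- exists (dual_connection nabla); split; last exact: hor.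
  exact: dual_linear_connection (lc_connection hnabla).
- move=> c [hc haff].
  exact: (affine_separable hg hf htrans hc hflat hnabla haff).
- move=> c [hc haff] i.
  exact: (affine_ignorable hg hf htrans hc hflat hnabla haff).
Qed.
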